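(* There are $\alpha,\beta>0$ such that for all non-superreflexive Banach spaces $X$, for all $\theta>0$, and for all $n=1,2,\dots$ there exists a Walsh-Paley martingale $\{M_k\}_0^n$ with values in the closed unit ball $B_X$ such that $$\inf_{1\le k\le n}\inf_{\omega\in\Omega_n}\|dM_k(\omega)\|\ge\frac{1}{2(1+\theta)}\quad\text{and}\quad \mu_n\Big\{\omega\in\Omega_n:\ \mathbb{E}_\varepsilon\Big\|\sum_{k=1}^n\varepsilon_k\,dM_k(\omega)\Big\|\ge\alpha n^{1/2}\Big\}>\beta.$$
   Context: Banach spaces are over $\mathbb{K}$ (the real or complex scalars). A Banach space $X$ is superreflexive if each Banach space which is finitely representable in $X$ is reflexive. Let $\Omega_n=\{-1,1\}^n$ with the uniform probability $\mu_n(\{\omega\})=2^{-n}$, let $\mathcal{F}_0=\{\emptyset,\Omega_n\}$ and let $\mathcal{F}_k$ be the $\sigma$-algebra generated by the coordinates $\omega_1,\dots,\omega_k$. A Walsh-Paley martingale $\{M_k\}_0^n$ with values in $X$ is an $X$-valued martingale over $(\Omega_n,\mu_n)$ with respect to $\{\mathcal{F}_k\}_0^n$ ($M_0$ is not assumed to be $0$); $dM_k:=M_k-M_{k-1}$ for $k\ge1$. $\mathbb{E}_\varepsilon$ is the expectation over $\varepsilon=(\varepsilon_1,\dots,\varepsilon_n)$ uniformly distributed on $\{-1,1\}^n$. *)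

(* Defs.v *)
From HB Require Import structures.
From mathcomp Require Import all_boot all_order all_algebra.
From mathcomp Require Import complex.
From mathcomp Require Import all_classical all_reals all_analysis.

Set Implicit Arguments.
Unset Strict Implicit.
Unset Printing Implicit Defensive.

Import Order.TTheory GRing.Theory Num.Theory.
Import numFieldNormedType.Exports.

Local Open Scope classical_set_scope.
Local Open Scope ring_scope.

(* [real_or_complex iota] says that K is R or R[i] and that iota is the
   inclusion of R into K.  It is needed because norms in a [normedModType K]
   are K-valued: a real bound c becomes [iota c] when compared with a norm. *)
Inductive real_or_complex (R : realType) :
    forall K : numFieldType, (R -> K) -> Prop :=
| real_scalars : @real_or_complex R R id
| complex_scalars : @real_or_complex R R[i] (real_complex R).

Section Superreflexivity.
Variable K : numFieldType.

Definition linear_on (U V : lmodType K) (E : set U) (T : U -> V) : Prop :=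
  forall (a : K) (u v : U), E u -> E v -> T (a *: u + v) = a *: T u + T v.

(* The operator norm of T restricted to E is at most c. *)
Definition opnorm_le (U V : normedModType K) (E : set U) (T : U -> V) (c : K)
  : Prop := 0 <= c /\ forall u : U, E u -> `|T u| <= c * `|u|.

Definition dual_space (X : normedModType K) : set (X -> K^o) :=
  [set f | linear f /\ continuous f].

(* An element of X** is a map on X -> K^o of which only the restriction to
   [dual_space X] matters; it is bounded if it is bounded on the unit ball of X*. *)
Definition bidual (X : normedModType K) : set ((X -> K^o) -> K^o) :=
  [set Phi | linear_on (@dual_space X) Phi /\
    exists C : K, forall f : X -> K^o,
      dual_space f -> opnorm_le setT f 1 -> `|Phi f| <= C].

(* The canonical embedding of X into X** is onto. *)
Definition reflexive_space (X : normedModType K) : Prop :=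
  forall Phi : (X -> K^o) -> K^o, bidual Phi ->
    exists x : X, forall f : X -> K^o, dual_space f -> Phi f = f x.

Definition lspan (V : lmodType K) (m : nat) (y : 'I_m -> V) : set V :=
  [set v | exists c : 'I_m -> K, v = \sum_(i < m) c i *: y i].

(* The finite-dimensional subspaces E of Y are the spans of finite families;
   T is an isomorphism of E onto T(E) with ||T|| <= a and ||T^-1|| <= b. *)
Definition finitely_representable (Y X : normedModType K) : Prop :=
  forall (m : nat) (y : 'I_m -> Y) (eps : K), 0 < eps ->
    exists (T : Y -> X) (a b : K),
      [/\ linear_on (lspan y) T,
          opnorm_le (lspan y) T a,
          0 <= b /\ (forall e : Y, lspan y e -> `|e| <= b * `|T e|) &
          a * b <= 1 + eps].

Definition superreflexive (X : completeNormedModType K) : Prop :=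
  forall Y : completeNormedModType K,
    finitely_representable Y X -> reflexive_space Y.

End Superreflexivity.

(* {-1,1}^n: the boolean b encodes the sign (-1)^b, and the coordinate omega_k
   (1 <= k <= n) is stored at index k - 1. *)
Definition Omega (n : nat) : finType := {ffun 'I_n -> bool}.

Definition mu (R : realType) (n : nat) (A : {set Omega n}) : R :=
  #|A|%:R / 2 ^+ n.

Definition integral_mu (K : numFieldType) (V : lmodType K) (n : nat)
    (A : set (Omega n)) (f : Omega n -> V) : V :=
  (2 ^- n : K) *: \sum_(w : Omega n | w \in A) f w.

Definition expect_mu (K : numFieldType) (V : lmodType K) (n : nat)
    (f : Omega n -> V) : V := integral_mu setT f.

Definition filtration (n k : nat) : set (set (Omega n)) :=
  <<s [set A | exists (i : 'I_n) (B : set bool),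
        (i < k)%N /\ A = (fun w : Omega n => w i) @^-1` B] >>.
Arguments filtration : clear implicits.

(* Only M 0, ..., M n matter.  The second condition is E[M_{k+1} | F_k] = M_k,
   integrability being automatic on a finite space. *)
Definition walsh_paley (K : numFieldType) (X : normedModType K) (n : nat)
    (M : nat -> Omega n -> X) : Prop :=
  (forall k : nat, (k <= n)%N ->
     forall U : set X, open U -> filtration n k (M k @^-1` U)) /\
  (forall k : nat, (k < n)%N ->
     forall A : set (Omega n), filtration n k A ->
       integral_mu A (M k.+1) = integral_mu A (M k)).

Definition dM (K : numFieldType) (X : normedModType K) (n : nat)
    (M : nat -> Omega n -> X) (k : nat) (w : Omega n) : X :=
  M k w - M k.-1 w.

(* E_eps || sum_{k=1}^n eps_k dM_k(w) || *)
Definition rademacher_average (K : numFieldType) (X : normedModType K)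
    (n : nat) (M : nat -> Omega n -> X) (w : Omega n) : K :=
  expect_mu (fun eps : Omega n =>
    `|\sum_(k < n) (-1) ^+ eps k *: dM M k.+1 w| : K^o).

(* Main.v *)
Require Import Defs.
From HB Require Import structures.
From mathcomp Require Import all_boot all_order all_algebra.
From mathcomp Require Import complex.
From mathcomp Require Import all_classical all_reals all_analysis.
From mathcomp Require Import zify ring lra.
Import Order.TTheory GRing.Theory Num.Theory.
Import numFieldNormedType.Exports.
Local Open Scope ring_scope.
Local Open Scope classical_set_scope.
Set Implicit Arguments.
Unset Strict Implicit.
Unset Printing Implicit Defensive.

(* Only real linear combinations matter, so the argument runs in a real vector
   space with a norm; a complex space is regarded as a real one, and an element
   of its bidual is replaced by [u |-> Re (Phi (u - i u(i .)))].

   A non-superreflexive space X finitely represents a non-reflexive Y. Take Phi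
   in Y**, of norm at most 1 and at distance more than r < 1 from Y (Riesz).
   Functionals f_k and vectors y_k are chosen alternately: Phi is larger than r
   somewhere on the unit ball of the annihilator of y_0, ..., y_(k-1), which
   yields f_k with Phi f_k = r, and Helly's theorem yields y_k almost in the unit
   ball with f_i(y_k) = Phi f_i = r for i <= k. As f_k(y_i) = r if k <= i and 0
   otherwise, |sum_i a_i y_i| >= r |sum_(i >= k) a_i| up to a factor close to 1,
   and finite representability moves these vectors to X (James).

   With 2^n such vectors in X, indexed by Omega n in lexicographic order, let
   M_k(w) be the average of x_v over the v that agree with w in the first k
   coordinates. Tail sums of the coefficients of dM_k(w) bound |dM_k(w)| from
   below by 1/2 (tail starting at the middle of the previous cell). In the tail
   starting at w itself, dM_k(w) contributes at least 1/4 in absolute value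
   whenever w_k differs from w_(k+1); a single functional thus sees about n/2
   increments of size at least 1/4 on average, and Khinchine's inequality gives
   a Rademacher average of order sqrt n for a fixed proportion of the w. *)

(** * Minimal sublinear functionals and the Hahn-Banach theorem *)

Section Sublinear.
Context {R : realType} {V : lmodType R}.
Implicit Types (p q : V -> R) (x y z : V) (t : R).

(** Homogeneity is stated as an inequality, the form that passes directly to infima; the inverse
    scalar turns it into an equality. *)
Definition sublinear p : Prop :=
  (forall x y, p (x + y) <= p x + p y) /\
  (forall t x, 0 < t -> p (t *: x) <= t * p x).

Lemma sublinear0 p : sublinear p -> p 0 = 0.
Proof.
move=> [pD pZ]; apply/eqP; rewrite eq_le.
have := pD 0 0; have := @pZ 2^-1 0; rewrite invr_gt0 ltr0n addr0 scaler0 => /(_ isT).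
move=> h1 h2; apply/andP; split; lra.
Qed.

Lemma sublinearZ p t x : sublinear p -> 0 <= t -> p (t *: x) = t * p x.
Proof.
move=> sp; rewrite le_eqVlt => /predU1P[<-|t0].
  by rewrite scale0r sublinear0// mul0r.
case: (sp) => _ pZ; apply/eqP; rewrite eq_le pZ//=.
have /(pZ t^-1 (t *: x)) : 0 < t^-1 by rewrite invr_gt0.
rewrite scalerA mulVf ?gt_eqF// scale1r => h.
by rewrite -(ler_pM2l (x := t^-1)) ?invr_gt0// mulrA mulVf ?gt_eqF// mul1r.
Qed.

Lemma sublinear_ge p x : sublinear p -> - p (- x) <= p x.
Proof.
move=> sp; case: (sp) => pD _; have := pD x (- x).
by rewrite subrr sublinear0// => h; lra.
Qed.

Definition infimum {I : Type} (P : I -> V -> R) x : R := inf (range (P^~ x)).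

Lemma infimum_le {I : Type} (P : I -> V -> R) (m : V -> R) i x :
  (forall i x, m x <= P i x) -> infimum P x <= P i x.
Proof.
by move=> mP; apply: ge_inf; [exists (m x) => _ [j _ <-]|exists i].
Qed.

Lemma infimum_ge {I : Type} (i0 : I) (P : I -> V -> R) c x :
  (forall i, c <= P i x) -> c <= infimum P x.
Proof.
by move=> cP; apply: lb_le_inf; [exists (P i0 x), i0|move=> _ [j _ <-]].
Qed.

(** The index [k] may depend on the points, which covers chains of functionals as well as families
    of translates; the lower bound [m] keeps the infima finite. *)
Lemma infimum_sublinear {I : Type} (i0 : I) (P : I -> V -> R) (m : V -> R) :
  (forall i x, m x <= P i x) ->
  (forall i j x y, exists k, P k (x + y) <= P i x + P j y) ->
  (forall i t x, 0 < t -> exists k, P k (t *: x) <= t * P i x) ->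
  sublinear (infimum P).
Proof.
move=> mP PD PZ; split=> [x y|t x t0].
  rewrite -lerBlDr; apply: (infimum_ge i0) => i.
  rewrite lerBlDr -lerBlDl; apply: (infimum_ge i0) => j.
  rewrite lerBlDl; have [k] := PD i j x y.
  by apply: le_trans; apply: (infimum_le _ _ mP).
rewrite mulrC -ler_pdivrMr//; apply: (infimum_ge i0) => i.
rewrite ler_pdivrMr// mulrC; have [k] := PZ i t x t0.
by apply: le_trans; apply: (infimum_le _ _ mP).
Qed.

Definition directional p y : V -> R :=
  infimum (fun (t : {t : R | 0 <= t}) x => p (x + sval t *: y) - sval t * p y).

Lemma directional_lb p y (t : {t : R | 0 <= t}) x : sublinear p ->
  - p (- x) <= p (x + sval t *: y) - sval t * p y.
Proof.
move=> sp; case: t => t t0 /=; rewrite -(sublinearZ y sp t0).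
case: (sp) => pD _; have := pD (- x) (x + t *: y).
by rewrite addKr => h; lra.
Qed.

Lemma directional_sublinear p y : sublinear p -> sublinear (directional p y).
Proof.
move=> sp; case: (sp) => pD pZ.
apply: (@infimum_sublinear _ (exist _ 0 (lexx 0)) _ (fun x => - p (- x))).
- by move=> i x; exact: directional_lb.
- move=> [s s0] [t t0] x z /=; exists (exist _ (s + t) (addr_ge0 s0 t0)) => /=.
  have := pD (x + s *: y) (z + t *: y).
  by rewrite addrACA -scalerDl => h; lra.
- move=> [s s0] t x t0 /=; exists (exist _ (t * s) (mulr_ge0 (ltW t0) s0)) => /=.
  have := pZ t (x + s *: y) t0; rewrite scalerDr scalerA => h; lra.
Qed.

Lemma directional_le p y t x : sublinear p -> 0 <= t ->
  directional p y x <= p (x + t *: y) - t * p y.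
Proof.
move=> sp t0; have := @infimum_le _ (fun (t : {t : R | 0 <= t}) x =>
  p (x + sval t *: y) - sval t * p y) (fun x => - p (- x)) (exist _ t t0) x.
apply=> i z; exact: directional_lb.
Qed.

(* A minimal sublinear functional is linear, since it agrees with its
   directional modifications; Zorn's lemma provides minimal ones. *)
Lemma sublinear_dominates_linear q : sublinear q ->
  exists g : V -> R, scalar g /\ forall x, g x <= q x.
Proof.
move=> sq.
pose T := {p : V -> R | sublinear p /\ forall x, p x <= q x}.
(* The order is reversed, so that a maximal element in Zorn's lemma is a minimal functional. *)
pose le_T (p1 p2 : T) := `[< forall x, sval p2 x <= sval p1 x >].
have q_T : sublinear q /\ forall x, q x <= q x by [].
have [|||A totA|[p [sp pq]] pmin] := @Zorn T le_T.
- by move=> p; apply/asboolP => x.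
- move=> p1 p2 p3 /asboolP h1 /asboolP h2; apply/asboolP => x.
  exact: le_trans (h2 x) (h1 x).
- move=> [p1 h1] [p2 h2] /asboolP /= a /asboolP /= b; apply: eq_exist => /=.
  by apply/funext => x; apply/eqP; rewrite eq_le a b.
- have [->|/set0P[p0 Ap0]] := eqVneq A set0; first by exists (exist _ q q_T).
  pose P (i : {p : T | A p}) : V -> R := sval (sval i).
  have P_lb i x : - q (- x) <= P i x.
    case: i => -[p [sp pq]] /= Ap; rewrite /P/=.
    by apply: le_trans (sublinear_ge x sp); rewrite lerN2.
  pose i0 : {p : T | A p} := exist _ p0 Ap0.
  have sP : sublinear (infimum P).
    apply: (@infimum_sublinear _ i0 _ (fun x => - q (- x))) => //.
    + move=> i j x y.
      have [k [ki kj]] : exists k : {p : T | A p},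
          (forall x, P k x <= P i x) /\ (forall x, P k x <= P j x).
        case: (i) (j) => [pi Ai] [pj Aj].
        have [/asboolP h|/asboolP h] := totA _ _ Ai Aj.
          by exists (exist _ pj Aj).
        by exists (exist _ pi Ai).
      exists k; apply: (@le_trans _ _ (P k x + P k y)); last exact: lerD.
      by rewrite /P; case: (sval k) => r [[rD _] _] /=.
    + move=> i t x t0; exists i; rewrite /P.
      by case: (sval i) => r [[_ rZ] _] /=; exact: rZ.
  have Pq x : infimum P x <= q x.
    apply: (le_trans (infimum_le i0 x P_lb)).
    by rewrite /P /=; case: (p0) => r [].
  exists (exist _ (infimum P) (conj sP Pq)) => s As; apply/asboolP => x /=.
  exact: (infimum_le (exist _ s As) x P_lb).
have pD x y : p (x + y) = p x + p y.
  apply/eqP; rewrite eq_le; case: (sp) => -> _ /=.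
  have dle z : directional p y z <= p z.
    by have := directional_le y z sp (lexx 0); rewrite scale0r addr0 mul0r subr0.
  have dT : sublinear (directional p y) /\ forall x, directional p y x <= q x.
    split; first exact: directional_sublinear.
    by move=> z; apply: le_trans (pq z).
  have := pmin (exist _ _ dT); rewrite /le_T /= => /(_ (asboolT dle)) /(congr1 sval) /= e.
  (* The parameter t = 1 gives [p x + p y <= p (x + y)]. *)
  have := directional_le y x sp ler01; rewrite e scale1r mul1r; lra.
exists p; split=> // a x y; rewrite pD; congr (_ + _).
have [a0|a0] := leP 0 a; first exact: sublinearZ.
have := pD (a *: x) (- a *: x).
rewrite -scalerDl subrr scale0r sublinear0// (sublinearZ (t := - a) x sp) ?oppr_ge0 ?ltW// => h.
lra.
Qed.

(** A linear functional below [directional q x] is below [q] (take t = 0), and its value at [- x] is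
    at most [- q x] (take t = 1), so it attains [q x] at [x]. *)
Lemma hahn_banach q x : sublinear q ->
  exists g : V -> R, [/\ scalar g, forall y, g y <= q y & g x = q x].
Proof.
move=> sq; have [g [lg gd]] := sublinear_dominates_linear (directional_sublinear x sq).
have gq y : g y <= q y.
  apply: (le_trans (gd y)).
  by have := directional_le x y sq (lexx 0); rewrite scale0r addr0 mul0r subr0.
exists g; split=> //; apply/eqP; rewrite eq_le gq /=.
have := le_trans (gd (- x)) (directional_le x (- x) sq ler01).
have g0 : g 0 = 0 by have := lg (-1) 0 0; rewrite scaler0 addr0; lra.
have := lg (-1) x 0; rewrite addr0 g0 addr0 scaleN1r scale1r mul1r addNr (sublinear0 sq).
by move=> ->; lra.
Qed.

End Sublinear.

(** * James's triangular sequences *)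

Section ScalarFunctionals.
Context {R : realType} {V : lmodType R}.
Implicit Types (f g : V -> R).

Lemma scalarD f : scalar f -> forall x y, f (x + y) = f x + f y.
Proof. by move=> lf x y; have := lf 1 x y; rewrite scale1r mul1r. Qed.

Lemma scalar0 f : scalar f -> f 0 = 0.
Proof. by move=> lf; have := scalarD lf 0 0; rewrite addr0; lra. Qed.

Lemma scalarZ f : scalar f -> forall a x, f (a *: x) = a * f x.
Proof. by move=> lf a x; have := lf a x 0; rewrite !addr0 scalar0// addr0. Qed.

Lemma scalarN f : scalar f -> forall x, f (- x) = - f x.
Proof. by move=> lf x; rewrite -scaleN1r scalarZ// mulN1r. Qed.

Lemma scalarB f : scalar f -> forall x y, f (x - y) = f x - f y.
Proof. by move=> lf x y; rewrite scalarD// scalarN. Qed.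

Lemma scalar_sum f (m : nat) (a : nat -> R) (y : nat -> V) : scalar f ->
  f (\sum_(i < m) a i *: y i) = \sum_(i < m) a i * f (y i).
Proof.
move=> lf; elim: m => [|m IH]; first by rewrite !big_ord0 scalar0.
by rewrite !big_ord_recr/= scalarD// scalarZ// IH.
Qed.

Lemma scalar_comb a f g : scalar f -> scalar g -> scalar (fun x => a * f x + g x).
Proof.
by move=> lf lg b x y; rewrite (lf b) (lg b) /=; ring.
Qed.

Lemma vanish_on_joint_kernel (m : nat) (f : nat -> V -> R) g :
  (forall k, (k < m)%N -> scalar (f k)) -> scalar g ->
  (forall x, (forall k, (k < m)%N -> f k x = 0) -> g x = 0) ->
  exists a : nat -> R, forall x, g x = \sum_(k < m) a k * f k x.
Proof.
elim: m g => [|m IH] g lf lg g0.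
  by exists (fun=> 0) => x; rewrite big_ord0 g0.
have lf' k : (k < m)%N -> scalar (f k) by move=> km; apply: lf; exact: ltnW.
have lfm := lf m (ltnSn m).
have [[x0 [x0k x0m]]|nx] := pselect (exists x0,
    (forall k, (k < m)%N -> f k x0 = 0) /\ f m x0 <> 0).
  pose b := - (g x0 / f m x0).
  have [||a ga] := IH (fun x => b * f m x + g x) lf'.
  - exact: scalar_comb.
  - move=> x xk; have := g0 (- (f m x / f m x0) *: x0 + x).
    rewrite (lg _ x0 x) /b => h.
    rewrite -[RHS]h => [/=|k]; first by ring.
    rewrite ltnS leq_eqVlt => /predU1P[->|km].
      by rewrite (lfm _ x0 x) /=; field; apply/eqP.
    by rewrite (lf' k km _ x0 x) /= (xk k km) (x0k k km) mulr0 addr0.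
  exists (fun k => if (k < m)%N then a k else - b) => x.
  rewrite big_ord_recr/= ltnn.
  under eq_bigr => k _ do rewrite ltn_ord.
  by rewrite -ga; ring.
have [|a ga] := IH g lf' lg.
  move=> x xk; apply: g0 => k; rewrite ltnS leq_eqVlt => /predU1P[->|]; last exact: xk.
  by apply: contrapT => fx; apply: nx; exists x.
exists (fun k => if (k < m)%N then a k else 0) => x.
rewrite big_ord_recr/= ltnn mul0r addr0 ga.
by apply: eq_bigr => k _; rewrite ltn_ord.
Qed.

(** Same dichotomy: either a multiple of [x0] corrects the last equation without disturbing the
    others, or [f m] is a combination of the others and compatibility forces the value [c m]. *)
Lemma linear_system (m : nat) (f : nat -> V -> R) (c : nat -> R) :
  (forall k, (k < m)%N -> scalar (f k)) ->
  (forall a : nat -> R, (forall x, \sum_(k < m) a k * f k x = 0) ->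
     \sum_(k < m) a k * c k = 0) ->
  exists y, forall k, (k < m)%N -> f k y = c k.
Proof.
elim: m => [|m IH] lf compat; first by exists 0.
have lf' k : (k < m)%N -> scalar (f k) by move=> km; apply: lf; exact: ltnW.
have lfm := lf m (ltnSn m).
have [|y yc] := IH lf'.
  move=> a a0; have := compat (fun k => if (k < m)%N then a k else 0).
  rewrite big_ord_recr/= ltnn mul0r addr0.
  under eq_bigr => k _ do rewrite ltn_ord.
  apply=> x; rewrite big_ord_recr/= ltnn mul0r addr0 -[RHS](a0 x).
  by apply: eq_bigr => k _; rewrite ltn_ord.
have [[x0 [x0k x0m]]|nx] := pselect (exists x0,
    (forall k, (k < m)%N -> f k x0 = 0) /\ f m x0 <> 0).
  exists ((c m - f m y) / f m x0 *: x0 + y) => k.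
  rewrite ltnS leq_eqVlt => /predU1P[->|km].
    by rewrite (lfm _ x0 y) /=; field; apply/eqP.
  by rewrite (lf' k km _ x0 y) /= (x0k k km) mulr0 add0r yc.
have [|a fa] := vanish_on_joint_kernel lf' lfm.
  by move=> x xk; apply: contrapT => fx; apply: nx; exists x.
exists y => k; rewrite ltnS leq_eqVlt => /predU1P[->|]; last exact: yc.
have := compat (fun k => if (k < m)%N then a k else - 1).
rewrite big_ord_recr/= ltnn.
under eq_bigr => i _ do rewrite ltn_ord -yc//.
rewrite -fa mulN1r => h; apply/eqP; rewrite -subr_eq0; apply/eqP; apply: h => x.
rewrite big_ord_recr/= ltnn.
under eq_bigr => i _ do rewrite ltn_ord.
by rewrite -fa mulN1r subrr.
Qed.

End ScalarFunctionals.

(** * Bidual elements over a real seminormed space *)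

Section James.
Context {R : realType} {V : lmodType R} (N : V -> R).
Hypothesis ND : forall x y, N (x + y) <= N x + N y.
Hypothesis NZ : forall t x, N (t *: x) = `|t| * N x.
Implicit Types (f g : V -> R) (Phi : (V -> R) -> R).

Let N0 : N 0 = 0.
Proof. by rewrite -(scale0r 0) NZ normr0 mul0r. Qed.

Let NN x : N (- x) = N x.
Proof. by rewrite -scaleN1r NZ normrN1 mul1r. Qed.

Let N_ge0 x : 0 <= N x.
Proof. by have := ND x (- x); rewrite subrr NN N0; lra. Qed.

Let N_sublinear : sublinear N.
Proof. by split=> // t x t0; rewrite NZ gtr0_norm. Qed.

(** Plain functions with an explicit bound [c] on the dual norm stand for elements of the dual. The
    bound is one-sided because [N] is even. *)
Definition dual_le (c : R) f : Prop :=
  [/\ 0 <= c, scalar f & forall x, f x <= c * N x].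

Definition linear_on_dual Phi : Prop :=
  forall a f g c d, dual_le c f -> dual_le d g ->
    Phi (fun x => a * f x + g x) = a * Phi f + Phi g.

Lemma dual_le_abs c f x : dual_le c f -> `|f x| <= c * N x.
Proof.
move=> [_ lf fc]; rewrite ler_norml fc andbT.
by have := fc (- x); rewrite scalarN// NN; lra.
Qed.

Lemma dual_le_comb a f g c d : dual_le c f -> dual_le d g ->
  dual_le (`|a| * c + d) (fun x => a * f x + g x).
Proof.
move=> hf hg; have [c0 lf _] := hf; have [d0 lg gd] := hg.
split; [by rewrite addr_ge0// mulr_ge0|exact: scalar_comb|move=> x].
rewrite mulrDl lerD// -mulrA; apply: (le_trans (ler_norm _)).
by rewrite normrM ler_wpM2l// dual_le_abs.
Qed.

Lemma dual_le0 c : 0 <= c -> dual_le c (fun=> 0).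
Proof.
by move=> c0; split=> [//|a x y /=|x]; [rewrite mulr0 addr0|rewrite mulr_ge0].
Qed.

Lemma dual_leZ a f c : dual_le c f -> dual_le (`|a| * c) (fun x => a * f x).
Proof.
move=> hf; have := dual_le_comb a hf (dual_le0 (lexx 0)); rewrite addr0.
by congr dual_le; apply/funext => x; rewrite addr0.
Qed.

Lemma dual_le_mono c d f : c <= d -> dual_le c f -> dual_le d f.
Proof.
move=> cd [c0 lf fc]; split=> //; first exact: le_trans cd.
by move=> x; apply: le_trans (fc x) _; rewrite ler_wpM2r.
Qed.

Lemma linear_on_dual0 Phi : linear_on_dual Phi -> Phi (fun=> 0) = 0.
Proof.
move=> lP; have d0 := dual_le0 (lexx 0).
have := lP 1 _ _ _ _ d0 d0.
by rewrite (_ : (fun x => _) = (fun=> 0)); [lra|apply/funext => x; rewrite mulr0 addr0].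
Qed.

Lemma linear_on_dualZ Phi a f c : linear_on_dual Phi -> dual_le c f ->
  Phi (fun x => a * f x) = a * Phi f.
Proof.
move=> lP hf; have := lP a _ _ _ _ hf (dual_le0 (lexx 0)).
rewrite linear_on_dual0// addr0 => <-; congr Phi.
by apply/funext => x; rewrite addr0.
Qed.

Lemma linear_on_dual_sum Phi (m : nat) (a : nat -> R) (f : nat -> V -> R) :
  linear_on_dual Phi -> (forall k, (k < m)%N -> dual_le 1 (f k)) ->
  Phi (fun x => \sum_(k < m) a k * f k x) = \sum_(k < m) a k * Phi (f k).
Proof.
(* [linear_on_dual] speaks only of functionals with a known bound, so the induction also carries a
   bound for the partial sums. *)
move=> lP; suff H : (forall k, (k < m)%N -> dual_le 1 (f k)) ->
    (exists d, dual_le d (fun x => \sum_(k < m) a k * f k x)) /\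
    Phi (fun x => \sum_(k < m) a k * f k x) = \sum_(k < m) a k * Phi (f k).
  by move=> /H[].
elim: m => [|m IH] hf.
  have -> : (fun x => \sum_(k < 0) a k * f k x) = (fun=> 0).
    by apply/funext => x; rewrite big_ord0.
  rewrite big_ord0 linear_on_dual0//; split=> //.
  by exists 0; exact: dual_le0.
have [|[d hd] IHm] := IH; first by move=> k km; apply: hf; exact: ltnW.
have hm := hf m (ltnSn m).
have -> : (fun x => \sum_(k < m.+1) a k * f k x) =
    (fun x => a m * f m x + \sum_(k < m) a k * f k x).
  by apply/funext => x; rewrite big_ord_recr/= addrC.
split; first by eexists; exact: dual_le_comb hm hd.
by rewrite (lP _ _ _ _ _ hm hd) big_ord_recr/= IHm addrC.
Qed.

Lemma linear_on_dual_sub Phi a y : linear_on_dual Phi ->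
  linear_on_dual (fun f => Phi f - a * f y).
Proof. by move=> lP b f g c d hf hg; rewrite (lP _ _ _ _ _ hf hg); ring. Qed.

(* The points of [ys] are removed one at a time, by a one-dimensional
   Hahn-Banach step in the dual. *)
Lemma near_point_of_annihilator (ys : seq V) Phi s : 0 <= s ->
  linear_on_dual Phi ->
  (forall f c, dual_le c f -> {in ys, forall y, f y = 0} -> Phi f <= s * c) ->
  exists e, forall f c, dual_le c f -> Phi f - f e <= s * c.
Proof.
move=> s0; elim: ys Phi => [|y ys IH] Phi lP Ps.
  exists 0 => f c hf; case: (hf) => _ lf _.
  by rewrite scalar0// subr0 Ps.
suff [a Pa] : exists a, forall f c, dual_le c f -> {in ys, forall y, f y = 0} ->
    Phi f - a * f y <= s * c.
  have [e ePhi] := IH _ (linear_on_dual_sub a y lP) Pa.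
  exists (a *: y + e) => f c hf; have [_ lf _] := hf.
  by have := ePhi f c hf; rewrite (lf a y e) /=; lra.
have Ps' f c : dual_le c f -> {in ys, forall y, f y = 0} -> f y = 0 -> Phi f <= s * c.
  move=> hf fys fy; apply: Ps => // z.
  by rewrite inE => /predU1P[->//|]; exact: fys.
(* After normalization to [f y = 1], functionals with [f y > 0] bound [a] from below by elements of
   [S], and those with [f y < 0] bound it from above by [Phi g + s * d]. The bounds are compatible
   because [f - g] vanishes at [y]; hence [a = sup S]. *)
pose S := [set r : R | exists f c,
  [/\ dual_le c f, {in ys, forall y, f y = 0}, f y = 1 & r = Phi f - s * c]].
have normalize f c : dual_le c f -> {in ys, forall y, f y = 0} -> f y != 0 ->
    [/\ dual_le (c / `|f y|) (fun x => (f y)^-1 * f x),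
        {in ys, forall y', (f y)^-1 * f y' = 0} & (f y)^-1 * f y = 1].
  move=> hf fys fy; split=> [|z /fys->|]; last by rewrite mulVf.
    by rewrite mulrC -normfV; exact: dual_leZ.
  by rewrite mulr0.
have [S0|S0] := pselect (S !=set0); last first.
  exists 0 => f c hf fys; rewrite mul0r subr0; apply: Ps' => //.
  apply: contrapT => /eqP fy; apply: S0; have [h1 h2 h3] := normalize f c hf fys fy.
  by eexists; exists (fun x => (f y)^-1 * f x), (c / `|f y|).
have S_ub g d : dual_le d g -> {in ys, forall y, g y = 0} -> g y = 1 ->
    ubound S (Phi g + s * d).
  move=> hg gys gy _ [f [c [hf fys fy ->]]].
  have h := dual_le_comb (-1) hg hf.
  have /(Ps' _ _ h) : {in ys, forall y0, -1 * g y0 + f y0 = 0}.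
    by move=> z zy; rewrite gys// fys//; ring.
  rewrite gy fy mulr1 addNr => /(_ erefl).
  by rewrite (lP _ _ _ _ _ hg hf) normrN1; lra.
have [_ [g [d [hg gys gy _]]]] := S0.
have S_sup : has_ubound S by exists (Phi g + s * d); exact: S_ub.
exists (sup S) => f c hf fys.
have [fy|fy] := eqVneq (f y) 0; first by rewrite fy mulr0 subr0 Ps'.
have [h1 h2 h3] := normalize f c hf fys fy.
have PhiE : Phi (fun x => (f y)^-1 * f x) = (f y)^-1 * Phi f.
  exact: linear_on_dualZ hf.
have [fy0|fy0] := ltP 0 (f y).
  have : Phi (fun x => (f y)^-1 * f x) - s * (c / `|f y|) <= sup S.
    by apply: ub_le_sup => //; exists (fun x => (f y)^-1 * f x), (c / `|f y|).
  rewrite PhiE gtr0_norm// => h.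
  have := ler_wpM2l (ltW fy0) h.
  rewrite mulrBr mulrA divff// mul1r.
  have -> : f y * (s * (c / f y)) = s * c by field.
  lra.
have {}fy0 : f y < 0 by rewrite lt_neqAle fy.
have := ge_sup S0 (S_ub _ _ h1 h2 h3).
rewrite PhiE ltr0_norm// => h.
have := ler_wnM2l (ltW fy0) h.
rewrite mulrDr mulrA divff// mul1r.
have -> : f y * (s * (c / - f y)) = - (s * c) by field.
lra.
Qed.

(** Let [y0] solve the equations and let [q] be the quotient seminorm modulo the joint kernel of the
    [f k]. A functional norming [y0] for [q] vanishes on that kernel, hence is a combination of the
    [f k]; its value at [y0] is its value under [Phi], so [q y0 <= 1]. Moving [y0] within the kernel
    nearly attains [q y0]. *)
Lemma helly (m : nat) (f : nat -> V -> R) Phi (eta : R) : 0 < eta ->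
  linear_on_dual Phi -> (forall f, dual_le 1 f -> Phi f <= 1) ->
  (forall k, (k < m)%N -> dual_le 1 (f k)) ->
  exists y, N y <= 1 + eta /\ forall k, (k < m)%N -> f k y = Phi (f k).
Proof.
move=> eta0 lP P1 hf.
have lf k : (k < m)%N -> scalar (f k) by move=> /hf[].
have [|y0 y0f] := @linear_system _ _ m f (Phi \o f) lf.
  move=> a a0; rewrite /= -(linear_on_dual_sum a lP hf).
  by rewrite (_ : (fun x => _) = (fun=> 0)) ?linear_on_dual0//; apply/funext.
pose I := {z : V | forall k, (k < m)%N -> f k z = 0}.
have f0 : forall k, (k < m)%N -> f k 0 = 0 by move=> k /lf /scalar0.
pose P (i : I) x := N (x + sval i).
have P0 i x : 0 <= P i x by exact: N_ge0.
pose q := infimum P.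
have q_le (i : I) x : q x <= N (x + sval i) by exact: (infimum_le i x P0).
have sq : sublinear q.
  apply: (@infimum_sublinear _ _ _ (exist _ 0 f0) P (fun=> 0)) => //.
  - move=> [z1 hz1] [z2 hz2] x y.
    have hz : forall k, (k < m)%N -> f k (z1 + z2) = 0.
      by move=> k km; rewrite scalarD ?hz1 ?hz2 ?addr0//; exact: lf.
    by exists (exist _ _ hz); rewrite /P/= addrACA.
  - move=> [z hz] t x t0.
    have htz : forall k, (k < m)%N -> f k (t *: z) = 0.
      by move=> k km; rewrite scalarZ ?hz ?mulr0//; exact: lf.
    by exists (exist _ _ htz); rewrite /P/= -scalerDr NZ gtr0_norm.
have [g [lg gq gy0]] := hahn_banach y0 sq.
have gN x : g x <= N x.
  by apply: le_trans (gq x) _; have := q_le (exist _ 0 f0) x; rewrite /= addr0.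
have gker z : (forall k, (k < m)%N -> f k z = 0) -> g z <= 0.
  move=> hz; have hNz : forall k, (k < m)%N -> f k (- z) = 0.
    by move=> k km; rewrite scalarN ?hz ?oppr0//; exact: lf.
  by apply: le_trans (gq z) _; have := q_le (exist _ _ hNz) z; rewrite /= subrr N0.
have [a ga] : exists a : nat -> R, forall x, g x = \sum_(k < m) a k * f k x.
  apply: vanish_on_joint_kernel => // z hz; apply/eqP; rewrite eq_le gker//=.
  rewrite -oppr_le0 -scalarN//; apply: gker => k km.
  by rewrite scalarN ?hz ?oppr0//; exact: lf.
have qy0 : q y0 <= 1.
  rewrite -gy0 ga; under eq_bigr => k _ do rewrite y0f//.
  rewrite /= -(linear_on_dual_sum a lP hf); apply: P1.
  rewrite (_ : (fun x => _) = g); last by apply/funext => x; rewrite ga.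
  by split=> // x; rewrite mul1r.
have [_ [i _ <-] Ni] : exists2 e, range (P^~ y0) e & e < q y0 + eta.
  apply: inf_adherent => //; split; first by exists (P (exist _ 0 f0) y0), (exist _ 0 f0).
  by exists 0 => _ [i _ <-].
exists (y0 + sval i); split; first by move: Ni; rewrite /P; lra.
move=> k km; rewrite scalarD; last exact: lf.
by rewrite (svalP i k km) addr0 y0f.
Qed.

Hypothesis N_complete : forall u : nat -> V,
  (forall e : R, 0 < e -> exists n0, forall n m, (n0 <= n)%N -> (n0 <= m)%N ->
     N (u n - u m) <= e) ->
  exists l, forall e : R, 0 < e -> exists n0, forall n, (n0 <= n)%N -> N (u n - l) <= e.

(** A complete space is closed in its bidual. Otherwise points [u n] within 1/(n+1) of [Phi] exist;
    norming functionals for [u n - u m] show that they form a Cauchy sequence, and their limit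
    represents [Phi]. *)
Lemma bidual_dist_gt0 Phi : linear_on_dual Phi ->
  (forall x, exists f c, dual_le c f /\ Phi f <> f x) ->
  exists2 delta : R, 0 < delta &
    forall x (s : R), (forall f, dual_le 1 f -> Phi f - f x <= s) -> delta <= s.
Proof.
move=> lP nPhi; apply: contrapT => nd.
have /choice[u uP] : forall n : nat, exists x, forall f, dual_le 1 f ->
    `|Phi f - f x| <= n.+1%:R^-1.
  move=> n; apply: contrapT => nx; apply: nd; exists n.+1%:R^-1.
    by rewrite invr_gt0 ltr0n.
  move=> x s xs; rewrite leNgt; apply/negP => sn; apply: nx; exists x => f hf.
  have hNf := dual_leZ (-1) hf; rewrite normrN1 mul1r in hNf.
  rewrite ler_norml; apply/andP; split; last exact: le_trans (xs f hf) (ltW sn).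
  rewrite lerNl; apply: le_trans (ltW sn).
  have := xs _ hNf; rewrite (linear_on_dualZ _ lP hf) /=; lra.
have [e e0|l ul] := N_complete (u := u).
  exists (Num.bound (2 / e)) => n m n0n n0m.
  have [f [lf fN fx]] := hahn_banach (u n - u m) N_sublinear.
  have hf : dual_le 1 f by split=> // x; rewrite mul1r.
  have small k : ((Num.bound (2 / e)) <= k)%N -> k.+1%:R^-1 <= e / 2 :> R.
    move=> n0k; rewrite -[leRHS]invrK lef_pV2 ?posrE ?invr_gt0 ?divr_gt0 ?ltr0n// invf_div.
    apply: (le_trans (ltW (archi_boundP _))); first by rewrite divr_ge0// ltW.
    by rewrite ler_nat ltnW.
  rewrite -fx scalarB//.
  have := le_trans (uP n f hf) (small n n0n).
  have := le_trans (uP m f hf) (small m n0m).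
  by rewrite !ler_norml => /andP[? ?] /andP[? ?]; lra.
have lPhi f : dual_le 1 f -> Phi f = f l.
  move=> hf; apply/eqP; rewrite -subr_eq0 -normr_le0; apply/ler_addgt0Pl => e e0.
  rewrite addr0; have [n0 n0P] := ul _ (divr_gt0 e0 (ltr0n _ 2)).
  pose k := maxn n0 (Num.bound (2 / e)).
  have small : k.+1%:R^-1 <= e / 2 :> R.
    rewrite -[leRHS]invrK lef_pV2 ?posrE ?invr_gt0 ?divr_gt0 ?ltr0n// invf_div.
    apply: (le_trans (ltW (archi_boundP _))); first by rewrite divr_ge0// ltW.
    rewrite ler_nat /k.
    exact: leq_trans (leq_maxr _ _) (leqnSn _).
  have := n0P k (leq_maxl _ _); have := le_trans (uP k f hf) small.
  have := dual_le_abs (u k - l) hf; have [_ lf _] := hf.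
  rewrite scalarB// mul1r !ler_norml => /andP[? ?] /andP[? ?] ?.
  by apply/andP; split; lra.
have [f [c [hf]]] := nPhi l; apply.
have [c0 _ _] := hf.
(* The bound [c] may be 0, hence the division by [c + 1] when rescaling to norm at most 1. *)
have c1 : 0 < (c + 1)^-1 by rewrite invr_gt0; lra.
have h : dual_le 1 (fun x => (c + 1)^-1 * f x).
  apply: (dual_le_mono _ (dual_leZ _ hf)).
  by rewrite gtr0_norm// mulrC ler_pdivrMr; lra.
have := lPhi _ h; rewrite (linear_on_dualZ _ lP hf) => /(congr1 ( *%R (c + 1))).
by rewrite !mulVKf//; lra.
Qed.

(** Riesz's lemma: subtract from [Phi] an almost nearest point [x0] and divide by the bound [s] on
    the remaining norm. *)
Lemma normalized_bidual Phi (C r : R) : linear_on_dual Phi ->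
  (forall f, dual_le 1 f -> Phi f <= C) ->
  (forall x, exists f c, dual_le c f /\ Phi f <> f x) -> 0 < r < 1 ->
  exists Psi, [/\ linear_on_dual Psi, forall f, dual_le 1 f -> Psi f <= 1 &
    forall x, ~ forall f, dual_le 1 f -> Psi f - f x <= r].
Proof.
move=> lP PC nP /andP[r0 r1]; have [delta delta0 deltaP] := bidual_dist_gt0 lP nP.
pose S := [set s : R | exists x, forall f, dual_le 1 f -> Phi f - f x <= s].
have S_lb : lbound S delta by move=> s [x]; exact: deltaP.
have S0 : S !=set0.
  by exists C, 0 => f hf; have [_ lf _] := hf; rewrite scalar0// subr0 PC.
have infS : delta <= inf S by apply: lb_le_inf.
(* The margin amounts to [s < inf S / r], so that the rescaled distance [inf S / s] exceeds [r]. *)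
have [s [x0 x0s] sS] : exists2 s, S s & s < inf S + (inf S / r - inf S).
  apply: inf_adherent; last by split=> //; exists delta.
  by rewrite subr_gt0 ltr_pdivlMr// gtr_pMr//; exact: lt_le_trans infS.
have iSs : inf S <= s by apply: ge_inf; [exists delta|exists x0].
have s0 : 0 < s by exact: lt_le_trans delta0 (le_trans infS iSs).
have {}sS : r * s < inf S by move: sS; rewrite addrC subrK ltr_pdivlMr// mulrC.
exists (fun f => s^-1 * (Phi f - 1 * f x0)); split.
- move=> a f g c d hf hg; rewrite (linear_on_dual_sub 1 x0 lP a hf hg); ring.
- by move=> f hf; rewrite mulrC ler_pdivrMr// !mul1r x0s.
- move=> x xr; suff : inf S <= r * s by rewrite leNgt sS.
  apply: ge_inf; first by exists delta.
  exists (s *: x + x0) => f hf; have [_ lf _] := hf.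
  have := ler_wpM2l (ltW s0) (xr f hf); rewrite mulrBr mulVKf ?gt_eqF//.
  by rewrite (lf s x x0) /=; lra.
Qed.

Lemma triangular_system Phi (r eta : R) (m : nat) : 0 < r -> 0 < eta ->
  linear_on_dual Phi -> (forall f, dual_le 1 f -> Phi f <= 1) ->
  (forall x, ~ forall f, dual_le 1 f -> Phi f - f x <= r) ->
  exists (y : nat -> V) (f : nat -> V -> R),
    [/\ forall i, (i < m)%N -> N (y i) <= 1 + eta,
        forall k, (k < m)%N -> dual_le 1 (f k) /\ Phi (f k) = r &
        forall i k, (i < m)%N -> (k < m)%N -> f k (y i) = r * (k <= i)%:R].
Proof.
move=> r0 eta0 lP P1 Pr; elim: m => [|m [y [f [yN fP fy]]]].
  by exists (fun=> 0), (fun=> N).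
(* If [Phi] were at most [r] on the unit ball of the annihilator of the earlier [y i], it would be
   within [r] of a point [e]. A functional violating this bound is scaled down to have value exactly
   [r] under [Phi]. *)
have [g [hg Pg gy]] : exists g, [/\ dual_le 1 g, Phi g = r &
    forall i, (i < m)%N -> g (y i) = 0].
  apply: contrapT => ng.
  have [|e eP] := @near_point_of_annihilator [seq y i | i <- iota 0 m] Phi r (ltW r0) lP.
    move=> g c hg gy; rewrite leNgt; apply/negP => rg; apply: ng.
    have [c0 _ _] := hg.
    have Pg0 : 0 < Phi g by apply: le_lt_trans rg; rewrite mulr_ge0// ltW.
    exists (fun x => r / Phi g * g x); split.
    - apply: (dual_le_mono _ (dual_leZ _ hg)).
      by rewrite gtr0_norm ?divr_gt0// mulrAC ler_pdivrMr// mul1r ltW.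
    - by rewrite (linear_on_dualZ _ lP hg) divfK// gt_eqF.
    - by move=> i im; rewrite gy ?mulr0//; apply/map_f; rewrite mem_iota.
  by apply: (Pr e) => g hg; have := eP g 1 hg; rewrite mulr1.
pose f' k := if (k < m)%N then f k else g.
have f'P k : (k < m.+1)%N -> dual_le 1 (f' k) /\ Phi (f' k) = r.
  by rewrite /f'; case: ifP => [km _|//]; exact: fP.
have [z [zN zf]] := helly eta0 lP P1 (fun k km => proj1 (f'P k km)).
exists (fun i => if (i < m)%N then y i else z), f'; split=> //.
- by move=> i _; case: ifP => // im; exact: yN.
- move=> i k im1 km1; case: ifP => im; last first.
    have -> : i = m by apply/eqP; rewrite eqn_leq -ltnS im1 leqNgt im.
    by rewrite zf// (proj2 (f'P k km1)) -ltnS km1 mulr1.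
  rewrite /f'; case: ifP => km; first exact: fy.
  have -> : k = m by apply/eqP; rewrite eqn_leq -ltnS km1 leqNgt km.
  by rewrite gy// leqNgt im mulr0.
Qed.

Lemma james_sequence Phi (C c : R) (m : nat) : linear_on_dual Phi ->
  (forall f, dual_le 1 f -> Phi f <= C) ->
  (forall x, exists f d, dual_le d f /\ Phi f <> f x) -> 0 < c < 1 ->
  exists y : nat -> V, (forall i, (i < m)%N -> N (y i) <= 1) /\
    forall (a : nat -> R) k,
      c * `|\sum_(i < m | (k <= i)%N) a i| <= N (\sum_(i < m) a i *: y i).
Proof.
move=> lP PC nP /andP[c0 c1].
have [|Psi [lPsi Psi1 Psir]] := normalized_bidual (r := (1 + c) / 2) lP PC nP.
  by apply/andP; split; lra.
(* Chosen so that [c * (1 + eta)] is the Riesz constant (1 + c)/2: dividing the vectors by [1 + eta]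
   leaves exactly the constant [c]. *)
pose eta := (1 - c) / (2 * c).
have eta0 : 0 < eta by rewrite divr_gt0// ?mulr_gt0//; lra.
have etaE : c * (1 + eta) = (1 + c) / 2 by rewrite /eta; field; rewrite gt_eqF.
have eta1 : 0 < 1 + eta by lra.
have r0 : 0 < (1 + c) / 2 by lra.
have [y [f [yN fP fy]]] := triangular_system m r0 eta0 lPsi Psi1 Psir.
exists (fun i => (1 + eta)^-1 *: y i); split.
  move=> i im; rewrite NZ gtr0_norm ?invr_gt0// mulrC ler_pdivrMr// mul1r.
  exact: yN.
move=> a k; have [km|mk] := ltnP k m; last first.
  rewrite big1 ?normr0 ?mulr0// => i /(leq_trans mk).
  by rewrite leqNgt ltn_ord.
under [in leRHS]eq_bigr => i _ do rewrite scalerA mulrC -scalerA.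
rewrite -scaler_sumr NZ (gtr0_norm (x := (1 + eta)^-1)) ?invr_gt0//.
rewrite [X in _ <= X]mulrC ler_pdivlMr//.
(* [f k] maps the combination to (1 + c)/2 times the tail sum from [k] on. *)
have [hf _] := fP k km; have [_ lf _] := hf.
have := dual_le_abs (\sum_(i < m) a i *: y i) hf; rewrite mul1r; apply: le_trans.
rewrite scalar_sum//.
under [in leRHS]eq_bigr => i _ do rewrite fy// mulrCA.
rewrite -mulr_sumr normrM (gtr0_norm r0) -etaE mulrAC ler_pM2l ?mulr_gt0//.
rewrite big_mkcond /= (eq_bigr (fun i : 'I_m => a i * (k <= i)%:R))// => i _.
by case: (k <= i)%N; rewrite ?mulr1 ?mulr0.
Qed.

End James.

(** * Real and complex scalars *)

Section NormedModules.
Context {K : numFieldType}.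

Lemma cauchy_seq_limit (Y : completeNormedModType K) (u : nat -> Y) :
  (forall e : K, 0 < e -> exists n0, forall n m, (n0 <= n)%N -> (n0 <= m)%N ->
     `|u n - u m| <= e) ->
  exists l, forall e : K, 0 < e -> exists n0, forall n, (n0 <= n)%N ->
    `|u n - l| <= e.
Proof.
move=> cu; have /cauchy_cvgP ul : cauchy (u @ \oo).
  apply/cauchy_exP => e e0; have [|n0 n0P] := cu (e / 2); first by rewrite divr_gt0.
  exists (u n0), n0 => // n /= n0n; rewrite -ball_normE /=.
  apply: le_lt_trans (n0P _ _ (leqnn _) n0n) _.
  by rewrite ltr_pdivrMr// ltr_pMr// ltr1n.
exists (lim (u @ \oo)) => e e0.
have /cvgrPdist_le /(_ e e0)[n0 _ n0P] := ul.
by exists n0 => n n0n; rewrite distrC; exact: n0P.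
Qed.

Context {X : normedModType K}.
Implicit Types f : X -> K^o.

Lemma dual_space_bounded f : dual_space f -> exists c : K,
  0 <= c /\ forall x, `|f x| <= c * `|x|.
Proof.
move=> [lf cf].
pose F : {linear X -> K^o} := HB.pack f (GRing.isLinear.Build K X K^o _ f lf).
have /linear_boundedP/pinfty_ex_gt0[r r0 rP] : bounded_near F (nbhs (0 : X)).
  by apply: continuous_linear_bounded; exact: cf.
by exists r; split; [exact: ltW|exact: rP].
Qed.

Lemma bounded_dual_space f (c : K) : linear f -> 0 <= c ->
  (forall x, `|f x| <= c * `|x|) -> dual_space f.
Proof.
move=> lf c0 fc; split=> //.
pose F : {linear X -> K^o} := HB.pack f (GRing.isLinear.Build K X K^o _ f lf).
apply: (@bounded_linear_continuous _ _ _ F); apply/linear_boundedP.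
exists c; split; first exact: ger0_real.
by move=> r cr x; apply: le_trans (fc x) _; rewrite ler_wpM2r// ltW.
Qed.

Lemma not_reflexive_spaceP : ~ reflexive_space X ->
  exists Phi : (X -> K^o) -> K^o, bidual Phi /\
    forall x, exists f, dual_space f /\ Phi f <> f x.
Proof.
move=> nX; apply: contrapT => h; apply: nX => Phi bPhi.
apply: contrapT => nx; apply: h; exists Phi; split=> // x.
apply: contrapT => nf; apply: nx; exists x => f df.
by apply: contrapT => ne; apply: nf; exists f.
Qed.

End NormedModules.

Lemma james_sequence_real (R : realType) (Y : completeNormedModType R) :
  ~ reflexive_space Y -> forall (c : R) (m : nat), 0 < c < 1 ->
  exists y : nat -> Y, (forall i, (i < m)%N -> `|y i| <= 1) /\
    forall (a : nat -> R) k,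
      c * `|\sum_(i < m | (k <= i)%N) a i| <= `|\sum_(i < m) a i *: y i|.
Proof.
move=> /not_reflexive_spaceP[Phi [[lPhi [C PhiC]] nPhi]] c m c01.
have dualP f d : dual_le Num.norm d f -> dual_space (f : Y -> R^o).
  move=> hf; have [d0 lf _] := hf.
  apply: (bounded_dual_space lf d0) => x; apply: dual_le_abs hf => //.
  exact: normrZ.
apply: (@james_sequence _ _ Num.norm _ _ _ Phi C) => //.
- exact: ler_normD.
- exact: normrZ.
- exact: cauchy_seq_limit.
- by move=> a f g d e /dualP df /dualP dg; exact: lPhi.
- move=> f hf; apply: (le_trans (ler_norm _)); apply: PhiC; first exact: dualP hf.
  split=> // x _; apply: dual_le_abs hf; exact: normrZ.
- move=> x; have [f [df fx]] := nPhi x; have [d [d0 fd]] := dual_space_bounded df.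
  exists f, d; split=> //; split=> //; first by case: df.
  by move=> z; apply: le_trans (ler_norm _) (fd z).
Qed.

(** * Complex spaces as real spaces *)

Section Realification.
Context {R : realType}.

(** An alias, so that the same vectors can carry a second module structure, over [R]. *)
Definition realification (Y : lmodType R[i]) : Type := Y.

HB.instance Definition _ (Y : lmodType R[i]) := GRing.Zmodule.on (realification Y).

Section Scaling.
Variable Y : lmodType R[i].

Definition real_scale (a : R) (x : realification Y) : realification Y :=
  real_complex R a *: (x : Y).

Fact real_scaleA a b x : real_scale a (real_scale b x) = real_scale (a * b) x.
Proof. by rewrite /real_scale scalerA -rmorphM. Qed.

Fact real_scale1 : left_id 1 real_scale.
Proof. by move=> x; rewrite /real_scale rmorph1 scale1r. Qed.

Fact real_scaleDr : right_distributive real_scale +%R.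
Proof. by move=> a x y; rewrite /real_scale scalerDr. Qed.

Fact real_scaleDl x : {morph real_scale^~ x : a b / a + b}.
Proof. by move=> a b; rewrite /real_scale rmorphD scalerDl. Qed.

HB.instance Definition _ := GRing.Zmodule_isLmodule.Build R (realification Y)
  real_scaleA real_scale1 real_scaleDr real_scaleDl.

End Scaling.

(** For a real-linear [u], this is the complex-linear functional with real part [u]. *)
Definition complexify (Y : lmodType R[i]) (u : realification Y -> R) : Y -> R[i] :=
  fun x => Complex (u x) (- u ('i%C *: (x : Y))).

End Realification.

Section ComplexJames.
Context {R : realType}.
Local Notation "a %:C" := (real_complex R a).

Lemma complexify_linear (Y : lmodType R[i]) (u : realification Y -> R) :
  scalar u -> linear (complexify u : Y -> R[i]^o).
Proof.
move=> lu [a b] x y.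
have realE (c : R) (z : Y) : u (c%:C *: z) = c * u z by exact: (scalarZ lu c z).
have uD (z1 z2 : Y) : u (z1 + z2) = u z1 + u z2 by exact: (scalarD lu z1 z2).
have abE : Complex a b = a%:C + b%:C * 'i%C.
  by apply/eqP; rewrite eq_complex/=; apply/andP; split; apply/eqP; ring.
have iabE : 'i%C * Complex a b = (- b)%:C + a%:C * 'i%C.
  by apply/eqP; rewrite eq_complex/=; apply/andP; split; apply/eqP; ring.
rewrite /complexify scalerDr scalerA iabE abE !scalerDl -!scalerA !uD !realE.
by apply/eqP; rewrite eq_complex/=; apply/andP; split; apply/eqP; ring.
Qed.

Lemma Re_scale (a : R) (z : R[i]^o) : complex.Re (a%:C *: z) = a * complex.Re z.
Proof. by case: z => x y /=; rewrite mul0r subr0. Qed.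

Variable Y : completeNormedModType R[i].

Definition real_norm (x : realification Y) : R := complex.Re `|x : Y|.

Lemma real_normE (x : Y) : `|x| = (real_norm x)%:C.
Proof. by rewrite /real_norm RRe_real// normr_real. Qed.

Lemma real_normD (x y : realification Y) :
  real_norm (x + y) <= real_norm x + real_norm y.
Proof. by have := ler_normD (x : Y) y; rewrite !real_normE -rmorphD lecR. Qed.

Lemma real_normZ t (x : realification Y) : real_norm (t *: x) = `|t| * real_norm x.
Proof.
apply: complexI; rewrite -real_normE (rmorphM (real_complex R)) /= -real_normE.
have -> : `|t|%:C = `|t%:C| by rewrite normc_def/= expr0n addr0 sqrtr_sqr.
exact: normrZ.
Qed.

Lemma normr_i : `|'i%C : R[i]| = 1.
Proof. by rewrite normc_def/= expr0n add0r expr1n sqrtr1. Qed.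

(** Bounding real and imaginary parts separately costs a factor 2, which affects only the bound on
    the bidual element and is absorbed by the Riesz normalization. *)
Lemma complexify_le (u : realification Y -> R) (c : R) :
  dual_le real_norm c u -> forall x, `|complexify u x| <= (c *+ 2)%:C * `|x|.
Proof.
move=> hu x; have ule y := dual_le_abs real_normZ y hu.
rewrite [complexify u x]complexE /= !real_normE; apply: (le_trans (ler_normD _ _)).
rewrite normrM normr_i mul1r -rmorphM mulrnAl mulr2n rmorphD lerD//.
  by rewrite normc_def/= expr0n addr0 sqrtr_sqr lecR ule.
rewrite normc_def/= expr0n addr0 sqrtr_sqr normrN lecR; apply: (le_trans (ule _)).
rewrite le_eqVlt; apply/orP; left; apply/eqP; congr (_ * _).
by apply: complexI; rewrite -!real_normE normrZ normr_i mul1r.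
Qed.

Lemma complexify_dual (u : realification Y -> R) (c : R) :
  dual_le real_norm c u -> dual_space (complexify u : Y -> R[i]^o).
Proof.
move=> hu; have [c0 lu _] := hu.
apply: (bounded_dual_space (complexify_linear lu) _ (complexify_le hu)).
by rewrite lecR mulrn_wge0.
Qed.

Lemma Re_dual_le (f : Y -> R[i]^o) : dual_space f -> exists d,
  dual_le real_norm d (fun x : realification Y => complex.Re (f x)).
Proof.
move=> df; have [c [c0 fc]] := dual_space_bounded df; have [lf _] := df.
exists (complex.Re c).
have cE : c = (complex.Re c)%:C by rewrite RRe_real// ger0_real.
split; first by move: c0; rewrite cE lecR.
- by move=> a x y /=; rewrite (lf a%:C x y) raddfD /= Re_scale.
- move=> x; apply: (le_trans (ler_norm _)); rewrite -lecR.
  apply: (le_trans (normc_ge_Re _)); rewrite (rmorphM (real_complex R)) /= -cE -real_normE; exact: fc.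
Qed.

Lemma Re_complexify (f : Y -> R[i]^o) : linear f ->
  complexify (fun x : realification Y => complex.Re (f x)) = f.
Proof.
move=> lf; apply/funext => x; rewrite /complexify.
have f0 : f 0 = 0 by have := lf (-1) 0 0; rewrite scaler0 addr0 scaleN1r addNr.
have -> : f ('i%C *: x) = 'i%C * f x by have := lf 'i%C x 0; rewrite !addr0 f0 addr0.
by rewrite mulrC ReiNIm opprK; case: (f x).
Qed.

Lemma james_sequence_complex :
  ~ reflexive_space Y -> forall (c : R) (m : nat), 0 < c < 1 ->
  exists y : nat -> Y, (forall i, (i < m)%N -> `|y i| <= 1) /\
    forall (a : nat -> R) k,
      (c * `|\sum_(i < m | (k <= i)%N) a i|)%:C <= `|\sum_(i < m) (a i)%:C *: y i|.
Proof.
move=> /not_reflexive_spaceP[Phi [[lPhi [C PhiC]] nPhi]] c m c01.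
pose PhiR (u : realification Y -> R) := complex.Re (Phi (complexify u)).
have complete (u : nat -> Y) : (forall e : R, 0 < e -> exists n0, forall n m,
      (n0 <= n)%N -> (n0 <= m)%N -> real_norm (u n - u m) <= e) ->
    exists l : Y, forall e : R, 0 < e -> exists n0, forall n, (n0 <= n)%N ->
      real_norm (u n - l) <= e.
  move=> cu; have [e e0|l ul] := @cauchy_seq_limit _ Y u.
    have eE : e = (complex.Re e)%:C by rewrite RRe_real// gtr0_real.
    have [|n0 n0P] := cu (complex.Re e); first by move: e0; rewrite eE ltcR.
    by exists n0 => n m' nn mn; rewrite real_normE eE lecR n0P.
  exists l => e e0; have [|n0 n0P] := ul e%:C; first by rewrite ltcR.
  by exists n0 => n nn; have := n0P n nn; rewrite real_normE lecR.
have lPhiR : linear_on_dual real_norm PhiR.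
  move=> a u v d e /complexify_dual du /complexify_dual dv.
  have := lPhi a%:C _ _ du dv; rewrite /PhiR.
  have -> : complexify (fun x => a * u x + v x) =
      (a%:C *: (complexify u : Y -> R[i]^o) + (complexify v : Y -> R[i]^o)).
    apply/funext => x; rewrite /complexify !fctE.
    by apply/eqP; rewrite eq_complex/=; apply/andP; split; apply/eqP; ring.
  by move=> ->; rewrite raddfD /= Re_scale.
have PhiRC u : dual_le real_norm 1 u -> PhiR u <= complex.Re C *+ 2.
  (* Halving [u] compensates the factor 2, so that its complexification lies in the dual unit
     ball. *)
  move=> hu; have h2 := dual_leZ real_normD real_normZ (2^-1) hu.
  have /(PhiC _ (complexify_dual h2)) :
      opnorm_le setT (complexify (fun x => 2^-1 * u x) : Y -> R[i]^o) 1.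
    split=> // x _; have := complexify_le h2 x.
    have -> // : (`|2^-1 : R| * 1) *+ 2 = 1.
    by rewrite (gtr0_norm (x := 2^-1 : R)) ?invr_gt0//; lra.
  move=> PC; have : PhiR (fun x => 2^-1 * u x) <= complex.Re C.
    rewrite -lecR; apply: le_trans (_ : `|Phi (complexify (fun x => 2^-1 * u x))| <= _).
      apply: le_trans (normc_ge_Re _); rewrite lecR; exact: ler_norm.
    by rewrite RRe_real// (ger0_real (le_trans (normr_ge0 _) PC)).
  rewrite (linear_on_dualZ real_normD real_normZ _ lPhiR hu) mulrC ler_pdivrMr//.
  by rewrite mulr_natr.
(* If [x] represented [PhiR], the real parts of [Phi f] and [f x] would agree for every [f]; applied
   to ['i *: f], this makes the imaginary parts agree too. *)
have nPhiR (x : realification Y) : exists u d, dual_le real_norm d u /\ PhiR u <> u x.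
  apply: contrapT => nu.
  have ReE f : dual_space f -> complex.Re (Phi f) = complex.Re (f x).
    move=> df; have [d hd] := Re_dual_le df; have [lf _] := df.
    apply: contrapT => ne; apply: nu.
    by eexists; exists d; split; [exact: hd|rewrite /PhiR Re_complexify].
  have [f [df]] := nPhi x; apply.
  have [c0 [c00 fc]] := dual_space_bounded df; have [lf _] := df.
  have dif : dual_space ('i%C *: f).
    apply: (bounded_dual_space _ c00) => [a y z|y].
      by rewrite !fctE lf scalerDr !scalerA mulrC.
    by rewrite fctE normrM normr_i mul1r.
  pose z0 : Y -> R[i]^o := fun=> 0.
  have d0 : dual_space z0.
    apply: (@bounded_dual_space _ Y z0 0) => // [a y z|y].
      by rewrite /z0 scaler0 addr0.
    by rewrite /z0 normr0 mul0r.
  have Phi0 : Phi z0 = 0.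
    have := lPhi (-1) _ _ d0 d0.
    rewrite (_ : -1 *: z0 + z0 = z0); first by rewrite scaleN1r addNr.
    by apply/funext => z; rewrite !fctE /z0 scaler0 addr0.
  have PhiI : Phi ('i%C *: f) = 'i%C * Phi f.
    have := lPhi 'i%C _ _ df d0.
    rewrite (_ : 'i%C *: f + z0 = 'i%C *: f); first by rewrite Phi0 addr0.
    by apply/funext => z; rewrite !fctE /z0 addr0.
  apply/eqP; rewrite eq_complex; apply/andP; split; first by rewrite ReE.
  have := ReE _ dif.
  by rewrite PhiI -[('i%C *: f) x]/('i%C * f x) !(mulrC 'i%C) !ReiNIm => /oppr_inj ->.
have [y [y1 yc]] := james_sequence real_normD real_normZ complete m lPhiR PhiRC nPhiR c01.
exists y; split=> [i im|a k]; rewrite real_normE lecR; [exact: y1|exact: yc].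
Qed.

End ComplexJames.

(** * From non-reflexive to non-superreflexive spaces *)

Lemma james_sequence_nonreflexive (R : realType) (K : numFieldType)
    (iota : R -> K) (Y : completeNormedModType K) :
  real_or_complex iota -> ~ reflexive_space Y ->
  forall (c : R) (m : nat), 0 < c < 1 ->
  exists y : nat -> Y, (forall i, (i < m)%N -> `|y i| <= 1) /\
    forall (a : nat -> R) k,
      iota (c * `|\sum_(i < m | (k <= i)%N) a i|) <=
        `|\sum_(i < m) iota (a i) *: y i|.
Proof.
move=> roc; case: K iota / roc Y => Y.
- exact: james_sequence_real.
- exact: james_sequence_complex.
Qed.

(** Treats both kinds of scalars at once: the martingale construction uses the inclusion only as an
    order-preserving ring morphism. *)
Lemma real_or_complex_rmorphism (R : realType) (K : numFieldType) (iota : R -> K) :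
  real_or_complex iota -> exists f : {rmorphism R -> K},
    iota = f /\ {mono f : x y / x <= y}.
Proof.
move=> roc; case: K iota / roc.
- by exists (idfun : {rmorphism R -> R}).
- exists (real_complex R : {rmorphism R -> R[i]}); split=> // x y.
  exact: lecR.
Qed.

Lemma linear_on_lspan_sum (K : numFieldType) (U V : normedModType K) (m : nat)
    (y : 'I_m -> U) (T : U -> V) (c : 'I_m -> K) : linear_on (lspan y) T ->
  T (\sum_(i < m) c i *: y i) = \sum_(i < m) c i *: T (y i).
Proof.
move=> lT.
have span0 : lspan y 0 by exists (fun=> 0); rewrite big1// => i _; rewrite scale0r.
have T0 : T 0 = 0 by have := lT (-1) 0 0 span0 span0; rewrite scaler0 addr0 scaleN1r addNr.
have spanD u v : lspan y u -> lspan y v -> lspan y (u + v).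
  move=> [a ->] [b ->]; exists (fun i => a i + b i).
  by rewrite -big_split; apply: eq_bigr => i _; rewrite scalerDl.
have spanZ a i : lspan y (a *: y i).
  exists (fun j => if j == i then a else 0).
  rewrite (bigD1 i)//= eqxx big1 ?addr0// => j /negPf->.
  by rewrite scale0r.
(* [T] is linear only on the span, so membership of the partial sums is carried along. *)
suff [_ ->] : lspan y (\sum_(i < m) c i *: y i) /\
    T (\sum_(i < m) c i *: y i) = \sum_(i < m) c i *: T (y i) by [].
apply: (big_ind2 (fun u v => lspan y u /\ T u = v)) => [//|u1 v1 u2 v2 [s1 <-] [s2 <-]|i _].
  by split; [exact: spanD|have := lT 1 u1 u2 s1 s2; rewrite !scale1r].
split=> //; have yi : lspan y (y i) by have := spanZ 1 i; rewrite scale1r.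
by have := lT (c i) _ _ yi span0; rewrite !addr0 T0 addr0.
Qed.

Lemma james_sequence_nonsuperreflexive (R : realType) (K : numFieldType)
    (iota : R -> K) (X : completeNormedModType K) :
  real_or_complex iota -> ~ superreflexive X ->
  forall (c : R) (m : nat), 0 < c < 1 ->
  exists x : nat -> X, (forall i, (i < m)%N -> `|x i| <= 1) /\
    forall (a : nat -> R) k,
      iota (c * `|\sum_(i < m | (k <= i)%N) a i|) <=
        `|\sum_(i < m) iota (a i) *: x i|.
Proof.
move=> roc nX c m /andP[c0 c1].
have [Y [fY nY]] : exists Y : completeNormedModType K,
    finitely_representable Y X /\ ~ reflexive_space Y.
  apply: contrapT => h; apply: nX => Y fY; apply: contrapT => nY.
  by apply: h; exists Y.
(* A constant strictly between [c] and 1; the ratio [c' / c] is the distortion allowed to [T]. *)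
pose c' := (1 + c) / 2.
have [|y [y1 yc]] := james_sequence_nonreflexive roc nY (c := c') m.
  by apply/andP; split; rewrite /c'; lra.
have [f [iotaE f_le]] := real_or_complex_rmorphism roc; rewrite {}iotaE in yc *.
have cc' : 1 < c' / c by rewrite ltr_pdivlMr// /c'; lra.
have e0 : 0 < f (c' / c - 1).
  by rewrite -(rmorph0 f) (leW_mono f_le) subr_gt0.
have [T [a [b [lT [a0 Ta] [b0 Tb] ab]]]] := fY m (fun i => y i) _ e0.
have span_comb (d : nat -> K) : lspan (fun i : 'I_m => y i) (\sum_(i < m) d i *: y i).
  by exists (fun i => d i).
have span_y i : (i < m)%N -> lspan (fun i : 'I_m => y i) (y i).
  move=> im; exists (fun j => if j == Ordinal im then 1 else 0).
  rewrite (bigD1 (Ordinal im))//= eqxx scale1r big1 ?addr0// => j /negPf->.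
  by rewrite scale0r.
exists (fun i => a^-1 *: T (y i)); split=> [i im|d k].
  rewrite normrZ normfV ger0_norm//.
  have [->|an0] := eqVneq a 0; first by rewrite invr0 mul0r ler01.
  have a_gt0 : 0 < a by rewrite lt_def an0.
  rewrite mulrC ler_pdivrMr// mul1r; apply: (le_trans (Ta _ (span_y i im))).
  by rewrite ler_piMr// y1.
set S := \sum_(i < m | _) _.
have := le_trans (yc d k) (Tb _ (span_comb (fun i => f (d i)))).
rewrite -/S => le_bT.
(* If [a = 0], then [T] vanishes on the [y i] and both sides are 0. *)
have TE : T (\sum_(i < m) f (d i) *: y i) =
    a *: \sum_(i < m) f (d i) *: (a^-1 *: T (y i)).
  rewrite (linear_on_lspan_sum (fun i => f (d i)) lT) scaler_sumr.
  apply: eq_bigr => i _; have [a00|an0] := eqVneq a 0.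
    have := Ta _ (span_y i (ltn_ord i)); rewrite a00 mul0r normr_le0 => /eqP->.
    by rewrite !scaler0.
  by rewrite !scalerA mulrAC mulfV// mul1r.
move: le_bT; rewrite TE normrZ (ger0_norm a0) mulrA (mulrC b) => le_ab.
have := le_trans le_ab (ler_wpM2r (normr_ge0 _) ab).
rewrite rmorphB rmorph1 addrC subrK => le_cc.
have c'0 : 0 < c' / c by apply: lt_trans cc'.
have fc0 : 0 < f (c' / c) by rewrite -(rmorph0 f) (leW_mono f_le).
rewrite -(ler_pM2l fc0); apply: le_trans le_cc.
rewrite -rmorphM f_le mulrA divfK ?gt_eqF//.
Qed.

(** * Sign sequences *)

Section SignSequences.
Context {n : nat}.
Implicit Types (v w : Omega n) (j : 'I_n) (k : nat).

Definition flip j w : Omega n := [ffun i => (i == j) (+) w i].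

(** Indexed by naturals and false from [n] on, so that the last digit also has a successor, namely
    0. *)
Definition bit w k : bool := [exists i : 'I_n, (i == k :> nat) && w i].

(** The classes of [agree k] are the atoms of the [k]-th sigma-algebra. *)
Definition agree k v w : bool := [forall i : 'I_n, (i < k)%N ==> (v i == w i)].

(* The number whose binary digits are [w 0, ..., w k.-1], most significant
   first; for [k = n] it enumerates [Omega n] in lexicographic order. *)
Fixpoint prefix_rank w k : nat :=
  if k is k'.+1 then ((prefix_rank w k').*2 + bit w k')%N else 0%N.

Definition rank w : nat := prefix_rank w n.

Lemma flipK j : involutive (flip j).
Proof. by move=> w; apply/ffunP => i; rewrite !ffunE addbA addbb. Qed.

Lemma flip_same j w : flip j w j = ~~ w j.
Proof. by rewrite ffunE eqxx. Qed.

Lemma flip_other j i w : i != j -> flip j w i = w i.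
Proof. by move=> /negPf ij; rewrite ffunE ij. Qed.

Lemma bit_ord w (i : 'I_n) : bit w i = w i.
Proof.
apply/existsP/idP => [[i' /andP[/eqP e wi]]|wi]; last by exists i; rewrite eqxx.
by rewrite -(val_inj e).
Qed.

Lemma bit_out w k : (n <= k)%N -> bit w k = false.
Proof.
move=> nk; apply/existsP => -[i /andP[/eqP ik _]].
by have := ltn_ord i; rewrite ik ltnNge nk.
Qed.

Lemma bit_flip j w k : k != j -> bit (flip j w) k = bit w k.
Proof.
move=> kj; have [nk|kn] := leqP n k; first by rewrite !bit_out.
by rewrite -[k]/(val (Ordinal kn)) !bit_ord flip_other.
Qed.

Lemma agreeP k v w :
  reflect (forall i : 'I_n, (i < k)%N -> v i = w i) (agree k v w).
Proof.
by apply: (iffP forallP) => h i; [move=> ik; have := h i; rewrite ik => /eqP|apply/implyP => /h->].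
Qed.

Lemma agree_sym k v w : agree k v w = agree k w v.
Proof. by apply/eq_forallb => i; rewrite eq_sym. Qed.

Lemma agree_trans k u v w : agree k u v -> agree k v w -> agree k u w.
Proof. by move=> /agreeP uv /agreeP vw; apply/agreeP => i ik; rewrite uv// vw. Qed.

Lemma agree_leq k l v w : (k <= l)%N -> agree l v w -> agree k v w.
Proof. by move=> kl /agreeP h; apply/agreeP => i ik; apply: h; apply: leq_trans kl. Qed.

Lemma agree0 v w : agree 0 v w. Proof. exact/agreeP. Qed.

Lemma agree_flip k j w : (k <= j)%N -> agree k (flip j w) w.
Proof.
move=> kj; apply/agreeP => i ik; rewrite flip_other//.
by apply: contraTneq ik => ->; rewrite -leqNgt.
Qed.

Lemma agree_flipl k j v w : (k <= j)%N -> agree k (flip j v) w = agree k v w.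
Proof.
move=> kj; apply/idP/idP; apply: agree_trans; last exact: agree_flip.
by rewrite agree_sym agree_flip.
Qed.

Lemma agreeS j v w : agree j.+1 v w = agree j v w && (v j == w j).
Proof.
apply/idP/andP => [h|[/agreeP h /eqP vw]].
  by split; [exact: agree_leq h|move/agreeP: h => ->].
apply/agreeP => i; rewrite ltnS leq_eqVlt => /predU1P[/val_inj->//|]; exact: h.
Qed.

Lemma agree_bit k l v w : agree k v w -> (l < k)%N -> bit v l = bit w l.
Proof.
move=> /agreeP h lk; have [nl|ln] := leqP n l; first by rewrite !bit_out.
by rewrite -[l]/(val (Ordinal ln)) !bit_ord h.
Qed.

Lemma prefix_rank_lt w k : (prefix_rank w k < 2 ^ k)%N.
Proof. by elim: k => [//|k] /=; rewrite expnS; case: (bit w k) => /=; lia. Qed.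

Lemma rank_lt w : (rank w < 2 ^ n)%N. Proof. exact: prefix_rank_lt. Qed.

Lemma rank_le v w : (forall i, v i -> w i) -> (rank v <= rank w)%N.
Proof.
move=> vw; suff H k : (prefix_rank v k <= prefix_rank w k)%N by exact: H.
elim: k => [//|k IH] /=.
have : (bit v k <= bit w k)%N.
  have [nk|kn] := leqP n k; first by rewrite !bit_out.
  by rewrite -[k]/(val (Ordinal kn)) !bit_ord; move: (vw (Ordinal kn)); case: (v _) => // ->.
by lia.
Qed.

(** The first differing digit decides: once the prefix ranks differ, doubling and adding a digit
    keeps the strict inequality. *)
Lemma rank_ltn j v w : agree j v w -> v j = false -> w j -> (rank v < rank w)%N.
Proof.
move=> vw vj wj; have prefE k : (k <= j)%N -> prefix_rank v k = prefix_rank w k.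
  by elim: k => [//|k IH kj] /=; rewrite IH 1?ltnW// (agree_bit vw kj).
rewrite /rank -(subnKC (ltn_ord j)); elim: (n - j.+1)%N => [|k IH].
  by rewrite addn0 /= prefE// !bit_ord vj wj addn0 addn1.
have stepE u l : prefix_rank u l.+1 = ((prefix_rank u l).*2 + bit u l)%N by [].
by rewrite addnS !(stepE _ (j.+1 + k)%N); move: IH; case: (bit v _); case: (bit w _) => /=; lia.
Qed.

End SignSequences.

(** * Averages over signs and Khinchine's inequality *)

Section Averages.
Context {R : realType} {n : nat}.
Implicit Types (v w e : Omega n) (j : 'I_n) (f : Omega n -> R) (h : 'I_n -> R).

Lemma card_Omega : #|{: Omega n}| = (2 ^ n)%N.
Proof. by rewrite card_ffun card_bool card_ord. Qed.

Lemma sum_flip_odd (P : pred (Omega n)) j f :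
  (forall w, P (flip j w) = P w) -> (forall w, P w -> f (flip j w) = - f w) ->
  \sum_(w | P w) f w = 0.
Proof.
move=> Pj fj; suff : \sum_(w | P w) f w = - \sum_(w | P w) f w by lra.
rewrite [LHS](reindex_inj (inv_inj (flipK j))) -sumrN.
by apply: eq_big => // w; rewrite Pj => /fj.
Qed.

(** The centred indicator of [w j == b] changes sign under [flip j]. *)
Lemma sum_half (P : pred (Omega n)) j (b : bool) f :
  (forall w, P (flip j w) = P w) -> (forall w, P w -> f (flip j w) = f w) ->
  \sum_(w | P w) (w j == b)%:R * f w = 2^-1 * \sum_(w | P w) f w.
Proof.
move=> Pj fj.
have := @sum_flip_odd P j (fun w => (w j == b)%:R * f w - 2^-1 * f w) Pj.
rewrite sumrB -mulr_sumr => h; apply/eqP; rewrite -subr_eq0; apply/eqP.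
apply: h => w Pw; rewrite flip_same fj//; case: b (w j) => -[] /=; lra.
Qed.

Lemma sum_agree k w : (k <= n)%N ->
  2 ^+ k / 2 ^+ n * \sum_(v | agree k v w) 1 = 1 :> R.
Proof.
have n2 : 2 ^+ n != 0 :> R by rewrite expf_neq0// pnatr_eq0.
elim: k => [_|k IH kn].
  rewrite (eq_bigl xpredT); last by move=> v; rewrite agree0.
  by rewrite sumr_const card_Omega expr0 mul1r natrX mulVf.
pose o := Ordinal kn; rewrite -[RHS](IH (ltnW kn)) exprS.
rewrite (eq_bigl (fun v => agree k v w && (v o == w o))); last by move=> v; exact: (agreeS o).
rewrite big_mkcondr /= (eq_bigr (fun v => (v o == w o)%:R * 1)); last first.
  by move=> v _; rewrite mulr1; case: (_ == _).
rewrite sum_half//; first by field.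
by move=> v; rewrite (agree_flipl (j := o)).
Qed.

Lemma sum_agree_half k w j (b : bool) : (k <= j)%N ->
  2 ^+ k / 2 ^+ n * \sum_(v | agree k v w) (v j == b)%:R = 2^-1 :> R.
Proof.
move=> kj; have kn : (k <= n)%N by apply: leq_trans kj (ltnW (ltn_ord j)).
under eq_bigr => v _ do rewrite -[_%:R]mulr1.
rewrite sum_half//; last by move=> v; rewrite agree_flipl.
by rewrite mulrCA sum_agree// mulr1.
Qed.

Lemma sum_agree_quarter k w (i j : 'I_n) (b b' : bool) :
  (k <= i)%N -> (k <= j)%N -> i != j ->
  2 ^+ k / 2 ^+ n * \sum_(v | agree k v w) (v j == b)%:R * (v i == b')%:R =
    2^-1 * 2^-1 :> R.
Proof.
move=> ki kj ij; rewrite sum_half; last 2 first.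
- by move=> v; rewrite agree_flipl.
- by move=> v _; rewrite flip_other.
by rewrite mulrCA sum_agree_half.
Qed.

(** Summation over a list lets the moments be computed by adding one index at a time. *)
Definition sign_sum (r : seq 'I_n) h e : R :=
  \sum_(j <- r) (-1) ^+ e j * h j.

Lemma sign_sum_flip (r : seq 'I_n) h j e : j \notin r ->
  sign_sum r h (flip j e) = sign_sum r h e.
Proof.
move=> jr; apply: eq_big_seq => i ir; rewrite flip_other//.
by apply: contraNneq jr => <-.
Qed.

Lemma sum_sign_odd j f : (forall e, f (flip j e) = f e) ->
  \sum_(e : Omega n) (-1) ^+ e j * f e = 0.
Proof.
move=> fj; apply: (@sum_flip_odd xpredT j) => // e _.
by rewrite flip_same fj; case: (e j); rewrite /= ?expr0 ?expr1; ring.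
Qed.

Lemma sum_const (c : R) : \sum_(e : Omega n) c = 2 ^+ n * c.
Proof. by rewrite sumr_const card_Omega -[LHS]mulr_natl natrX. Qed.

(** On expanding the powers, the terms with an odd power of the new sign cancel. *)
Lemma sign_sum_moments (r : seq 'I_n) h : uniq r ->
  \sum_(e : Omega n) sign_sum r h e ^+ 2 = 2 ^+ n * \sum_(j <- r) h j ^+ 2 /\
  \sum_(e : Omega n) sign_sum r h e ^+ 4 <= 2 ^+ n * (3 * (\sum_(j <- r) h j ^+ 2) ^+ 2).
Proof.
elim: r => [_|j r IH /= /andP[jr ur]].
  rewrite !big_nil; under eq_bigr => e _ do rewrite /sign_sum big_nil expr0n.
  under [in X in _ /\ X]eq_bigr => e _ do rewrite /sign_sum big_nil expr0n.
  by rewrite !big1// expr0n !mulr0.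
have [IH2 IH4] := IH ur; set Q := \sum_(j <- r) _ in IH2 IH4.
have S0 f : (forall e, f (flip j e) = f e) -> \sum_(e : Omega n) (-1) ^+ e j * f e = 0.
  exact: sum_sign_odd.
have SE e : sign_sum (j :: r) h e = (-1) ^+ e j * h j + sign_sum r h e.
  by rewrite /sign_sum big_cons.
rewrite big_cons -/Q; split.
  have E2 e : sign_sum (j :: r) h e ^+ 2 =
      sign_sum r h e ^+ 2 + h j ^+ 2 + (-1) ^+ e j * (2 * h j * sign_sum r h e).
    by rewrite SE; case: (e j); rewrite /= ?expr0 ?expr1; ring.
  under eq_bigr => e _ do rewrite E2.
  rewrite !big_split/= IH2 sum_const S0; first by ring.
  by move=> e; rewrite sign_sum_flip.
have E4 e : sign_sum (j :: r) h e ^+ 4 =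
    sign_sum r h e ^+ 4 + 6 * h j ^+ 2 * sign_sum r h e ^+ 2 + h j ^+ 4 +
    (-1) ^+ e j * (4 * h j * sign_sum r h e ^+ 3 + 4 * h j ^+ 3 * sign_sum r h e).
  rewrite SE; case: (e j); rewrite /= ?expr0 ?expr1; ring.
under eq_bigr => e _ do rewrite E4.
rewrite !big_split/= -mulr_sumr IH2 sum_const S0; last first.
  by move=> e; rewrite sign_sum_flip.
have n2 : 0 <= 2 ^+ n * h j ^+ 4 :> R.
  by apply: mulr_ge0; [exact: exprn_ge0|exact: exprn_even_ge0].
(* The square exceeds what the expansion requires by the nonnegative last term. *)
have -> : 2 ^+ n * (3 * (h j ^+ 2 + Q) ^+ 2) =
  2 ^+ n * (3 * Q ^+ 2) + 6 * h j ^+ 2 * (2 ^+ n * Q) +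
  2 ^+ n * h j ^+ 4 + 2 * (2 ^+ n * h j ^+ 4) by ring.
lra.
Qed.

(** Fourth-moment method: for u normalized to second moment 1, the fourth moment is at most 3, and
    averaging u >= u^2 - 4 u^4 / 27 gives 1 - 12/27 = 5/9. *)
Lemma khinchine h :
  5 / 9 * Num.sqrt (\sum_j h j ^+ 2) <=
    (2 ^+ n)^-1 * \sum_(e : Omega n) `|\sum_j (-1) ^+ e j * h j|.
Proof.
set Q := \sum_j h j ^+ 2; have Q0 : 0 <= Q by apply: sumr_ge0 => j _; exact: sqr_ge0.
have n2 : 0 < 2 ^+ n :> R by exact: exprn_gt0.
have [s0|s0] := eqVneq (Num.sqrt Q) 0.
  by rewrite s0 mulr0; apply: mulr_ge0; [rewrite invr_ge0 ltW|exact: sumr_ge0].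
set s := Num.sqrt Q in s0 *.
have s_gt0 : 0 < s by rewrite lt_def s0 sqrtr_ge0.
have QE : Q = s ^+ 2 by rewrite sqr_sqrtr.
have [] := sign_sum_moments h (index_enum_uniq 'I_n); rewrite -/Q QE => M2 M4.
rewrite [X in _ <= X]mulrC ler_pdivlMr//.
(* [u >= u^2 - 4 u^4 / 27] for [u >= 0], with equality at [u = 3/2]. *)
have low e : s^-1 * sign_sum (index_enum 'I_n) h e ^+ 2 -
    4 / 27 * s^-1 ^+ 3 * sign_sum (index_enum 'I_n) h e ^+ 4 <= `|\sum_j (-1) ^+ e j * h j|.
  rewrite -/(sign_sum _ h e); set S := sign_sum _ h e.
  have -> : S ^+ 4 = `|S| ^+ 4 by rewrite -[4%N]/(2 * 2)%N !exprM real_normK ?num_real.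
  have -> : S ^+ 2 = `|S| ^+ 2 by rewrite real_normK ?num_real.
  set u := `|S|; have u0 : 0 <= u by exact: normr_ge0.
  rewrite -subr_ge0.
  have -> : u - (s^-1 * u ^+ 2 - 4 / 27 * s^-1 ^+ 3 * u ^+ 4) =
    4 / 27 * u * s^-1 ^+ 3 * ((u - 3 / 2 * s) ^+ 2 * (u + 3 * s)) by field.
  apply: mulr_ge0; last by apply: mulr_ge0; [exact: sqr_ge0|lra].
  apply: mulr_ge0; last by rewrite exprn_ge0// invr_ge0 ltW.
  by apply: mulr_ge0; first lra.
have /le_trans : 5 / 9 * s * 2 ^+ n <= \sum_(e : Omega n)
    (s^-1 * sign_sum (index_enum 'I_n) h e ^+ 2 -
     4 / 27 * s^-1 ^+ 3 * sign_sum (index_enum 'I_n) h e ^+ 4).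
  rewrite sumrB -!mulr_sumr M2.
  have : 4 / 27 * s^-1 ^+ 3 * \sum_(e : Omega n) sign_sum (index_enum 'I_n) h e ^+ 4 <=
      4 / 27 * s^-1 ^+ 3 * (2 ^+ n * (3 * (s ^+ 2) ^+ 2)).
    rewrite ler_wpM2l//; apply: mulr_ge0; first lra.
    by rewrite exprn_ge0// invr_ge0 ltW.
  have -> : 4 / 27 * s^-1 ^+ 3 * (2 ^+ n * (3 * (s ^+ 2) ^+ 2)) = 4 / 9 * s * 2 ^+ n by field.
  have -> : s^-1 * (2 ^+ n * s ^+ 2) = s * 2 ^+ n by field.
  lra.
by apply; apply: ler_sum => e _; exact: low.
Qed.

Definition turns w : nat := #|[pred j : 'I_n | w j != bit w j.+1]|.

(** Flipping [w j] leaves the next digit alone and toggles whether [j] is a turn, so each position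
    is a turn for half of the sequences. *)
Lemma sum_turns : \sum_(w : Omega n) (turns w)%:R = n%:R / 2 * 2 ^+ n :> R.
Proof.
under eq_bigr => w _ do rewrite /turns -sum1_card natr_sum big_mkcond /=.
rewrite exchange_big /=.
rewrite (eq_bigr (fun=> 2^-1 * 2 ^+ n)); first
  by rewrite sumr_const card_ord -[LHS]mulr_natl mulrA.
move=> j _; apply/eqP; rewrite -subr_eq0.
have -> : 2^-1 * 2 ^+ n = \sum_(w : Omega n) 2^-1 :> R by rewrite sum_const mulrC.
rewrite -sumrB; apply/eqP/(@sum_flip_odd xpredT j) => // w _ /=.
rewrite !inE flip_same bit_flip ?gtn_eqF//.
by case: (w j); case: (bit w j.+1) => /=; lra.
Qed.

(** Since [turns] has mean n/2 and maximum at most n, the good proportion p satisfies 2n <= n + 3np,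
    so p >= 1/3. *)
Lemma many_turns : (0 < n)%N ->
  4^-1 < #|[set w : Omega n | (n <= 4 * turns w)%N]%SET|%:R / 2 ^+ n :> R.
Proof.
move=> n0; set P := #|_|%:R; rewrite ltr_pdivlMr ?exprn_gt0//.
have n0R : 0 < n%:R :> R by rewrite ltr0n.
have bound w : 4 * (turns w)%:R <=
    n%:R + 3 * n%:R * (w \in [set w : Omega n | (n <= 4 * turns w)%N]%SET)%:R :> R.
  have tn : (turns w <= n)%N by rewrite -[leqRHS]card_ord max_card.
  rewrite inE; have [h|h] := leqP n (4 * turns w).
    have : (turns w)%:R <= n%:R :> R by rewrite ler_nat.
    by rewrite mulr1; lra.
  by rewrite mulr0 addr0 -natrM ler_nat ltnW.
have : 4 * \sum_(w : Omega n) (turns w)%:R <= 2 ^+ n * n%:R + 3 * n%:R * P :> R.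
  rewrite mulr_sumr; apply: (le_trans (ler_sum _ (fun w _ => bound w))).
  rewrite big_split/= sum_const -mulr_sumr lerD2l ler_wpM2l ?mulr_ge0//.
  rewrite /P -sum1_card natr_sum [X in _ <= X]big_mkcond/=.
  by apply: ler_sum => w _; case: ifP.
rewrite sum_turns => h.
have : n%:R * (2 ^+ n) <= n%:R * (3 * P) by lra.
rewrite ler_pM2l// => h3.
have : 0 < 2 ^+ n :> R by exact: exprn_gt0.
lra.
Qed.

End Averages.

(** * Tail sums of the increments *)

Section Increments.
Context {R : realType} {n : nat}.
Implicit Types (v w : Omega n) (j : 'I_n).

Definition cell_density k w v : R := 2 ^+ k / 2 ^+ n * (agree k v w)%:R.

(** Coefficients of the increment from step [j] to step [j + 1]: positive on the half of the old
    cell that contains [w], negative on the other half. *)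
Definition increment_density j w v : R :=
  2 ^+ j / 2 ^+ n * (agree j v w)%:R * (if v j == w j then 1 else -1).

Definition tail_sum (t : nat) (a : Omega n -> R) : R := \sum_(v | (t <= rank v)%N) a v.

Lemma cell_densityB j w v :
  cell_density j.+1 w v - cell_density j w v = increment_density j w v.
Proof.
rewrite /cell_density /increment_density agreeS exprS.
have n2 : 2 ^+ n != 0 :> R by rewrite expf_neq0// pnatr_eq0.
by case: (agree _ _ _); case: (v j == w j) => /=; field.
Qed.

Lemma increment_density_flip j w v :
  increment_density j (flip j w) v = - increment_density j w v.
Proof.
rewrite /increment_density flip_same agree_sym agree_flipl// agree_sym.
by case: (v j) (w j) => -[] /=; ring.
Qed.

Lemma tail_sum_increment t j w : tail_sum t (increment_density j w) =
  2 ^+ j / 2 ^+ n * \sum_(v | agree j v w)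
     (t <= rank v)%N%:R * (if v j == w j then 1 else -1).
Proof.
rewrite /tail_sum mulr_sumr big_mkcond [RHS]big_mkcond /=; apply: eq_bigr => v _.
by rewrite /increment_density; case: (t <= _)%N; case: (agree _ _ _) => /=; ring.
Qed.

Lemma half_tail j w : exists t, `|tail_sum t (increment_density j w)| = 2^-1.
Proof.
(* The first point of the upper half of the cell: the tail from [u] meets the cell exactly where
   [v j] is true. *)
pose u : Omega n := [ffun i : 'I_n => if (i < j)%N then w i else i == j].
have uw : agree j u w by apply/agreeP => i ij; rewrite ffunE ij.
have uj : u j = true by rewrite ffunE ltnn eqxx.
exists (rank u); rewrite tail_sum_increment.
have rank_u v : agree j v w -> (rank u <= rank v)%N = v j.
  move=> vw; case vj : (v j).
    apply: rank_le => i; rewrite ffunE; case: ltnP => [ij|_ /eqP->//].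
    by move/agreeP: vw => ->.
  apply/negbTE; rewrite -ltnNge; apply: (rank_ltn (j := j)) => //.
  by apply: agree_trans vw _; rewrite agree_sym.
rewrite (eq_bigr (fun v => (v j == true)%:R * (if w j then 1 else -1))); last first.
  by move=> v vw; rewrite rank_u//; case: (v j); case: (w j); rewrite /= ?mul0r.
rewrite -mulr_suml mulrA sum_agree_half//.
by case: (w j); rewrite ?mulrN ?mulr1 ?normrN ger0_norm ?invr_ge0.
Qed.

(** Consider the part of the cell from [w] on. If the digits of [w] at j, j+1 are 1, 0, it lies in
    the positive half and contains the quarter with digits 1, 1. If they are 0, 1, it contains the
    whole negative half, of mass 1/2, and at most a quarter from the positive half. *)
Lemma turn_tail j w : w j != bit w j.+1 ->
  4^-1 <= `|tail_sum (rank w) (increment_density j w)|.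
Proof.
have n2 : 0 <= 2 ^+ j / 2 ^+ n :> R by rewrite divr_ge0 ?exprn_ge0.
rewrite tail_sum_increment; case wj : (w j); case wj1 : (bit w j.+1) => // _.
- apply: le_trans (ler_norm _); have [jn|nj] := ltnP j.+1 n.
    pose i := Ordinal jn; have ij : i != j by rewrite -val_eqE /= gtn_eqF.
    have ji : (j <= i)%N by rewrite /= leqnSn.
    have wi : w i = false by rewrite -bit_ord.
    have -> : 4^-1 = 2^-1 * 2^-1 :> R by lra.
    rewrite -(@sum_agree_quarter R n j w i j true true (leqnSn j) (leqnn j) ij).
    rewrite ler_wpM2l//; apply: ler_sum => v vw.
    case vj : (v j); case vi : (v i); rewrite /= ?mulr1 ?mulr0 ?mul0r ?ler0n//.
    + by rewrite ltnW// (rank_ltn (j := i))// agree_sym /= agreeS vw vj wj.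
    + by rewrite leqNgt (rank_ltn (j := j))// mul0r.
    + by rewrite leqNgt (rank_ltn (j := j))// mul0r.
  (* At the last coordinate the cell has two points and [w] is the upper one, so [w] alone
     contributes 1/2. *)
  apply: (@le_trans _ _ 2^-1); first lra.
  rewrite -(@sum_agree_half R n j w j true (leqnn j)).
  rewrite ler_wpM2l//; apply: ler_sum => v vw.
  case vj : (v j); rewrite /= ?mulr1 ?mulr0 ?mul0r ?ler0n//.
    have /agreeP vw' : agree j.+1 v w by rewrite agreeS vw vj wj.
    suff -> : v = w by rewrite leqnn.
    by apply/ffunP => i; apply: vw'; apply: leq_trans nj.
  by rewrite leqNgt (rank_ltn (j := j))// mul0r.
- have jn : (j.+1 < n)%N by rewrite ltnNge; apply: contraTN isT => /(bit_out w); rewrite wj1.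
  pose i := Ordinal jn; have ij : i != j by rewrite -val_eqE /= gtn_eqF.
  have wi : w i = true by rewrite -bit_ord.
  rewrite -normrN; apply: le_trans (ler_norm _).
  have -> : 4^-1 = 2^-1 - 2^-1 * 2^-1 :> R by lra.
  rewrite -{1}(@sum_agree_half R n j w j true (leqnn j)).
  rewrite -(@sum_agree_quarter R n j w i j false true (leqnSn j) (leqnn j) ij).
  rewrite -mulrBr -mulrN ler_wpM2l// -sumrB -sumrN; apply: ler_sum => v vw.
  case vj : (v j); case vi : (v i); rewrite /= ?mulr1 ?mul1r ?mulr0 ?mul0r ?subr0 ?sub0r ?oppr0.
  + by rewrite ltnW ?(rank_ltn (j := j)) 1?agree_sym// mul1r opprK.
  + by rewrite ltnW ?(rank_ltn (j := j)) 1?agree_sym// mul1r opprK.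
  + by rewrite lerN2 lern1 leq_b1.
  + by rewrite leqNgt (rank_ltn (j := i))//= ?oppr0// agreeS vw vj wj.
Qed.

End Increments.

(** * Sets of the Walsh-Paley filtration *)

Section Filtration.
Context {n : nat}.
Implicit Types (A : set (Omega n)) (v w : Omega n).

(** Saturated sets form a sigma-algebra containing the generators. *)
Lemma filtration_saturated k A : filtration n k A ->
  forall v w, agree k v w -> A v -> A w.
Proof.
move=> /(_ [set B | forall v w, agree k v w -> B v -> B w]); apply; split.
  split=> [//|B sB v w vw [_ nBv]|F sF v w vw [i _ Fv]].
    by split=> // Bw; apply: nBv; apply: sB Bw; rewrite agree_sym.
  by exists i => //; exact: sF Fv.
move=> _ [i [B [ik ->]]] v w /agreeP vw /=.
by rewrite vw.
Qed.

(** A saturated set is a finite union of atoms, each a finite intersection of generators. *)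
Lemma saturated_filtration k A :
  (forall v w, agree k v w -> A v -> A w) -> filtration n k A.
Proof.
move=> sA.
pose G := [set A | exists (i : 'I_n) (B : set bool),
  (i < k)%N /\ A = (fun w : Omega n => w i) @^-1` B].
have -> : A = \bigcup_(v in A) \bigcap_(i in [set i : 'I_n | (i < k)%N])
    ((fun w : Omega n => w i) @^-1` [set v i]).
  apply/seteqP; split=> [v Av|w [v Av vw]]; first by exists v.
  by apply: sA Av; apply/agreeP => i ik; rewrite (vw i ik).
have SU : fin_bigcup_closed <<s G>>.
  apply/fin_bigcup_closedP; split; first exact: sigma_algebra0.
  move=> B C GB GC; rewrite -bigcup2E; apply: sigma_algebra_bigcup.
  by case=> [|[|i]] //=; exact: sigma_algebra0.
have SC B : <<s G>> B -> <<s G>> (~` B).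
  by rewrite -setTD; exact: sigma_algebraCD.
apply: (SU) => [|v _]; first exact: finite_finset.
rewrite -[X in <<s G>> X]setCK setC_bigcap; apply: (SC); apply: (SU) => [|i ik].
  exact: finite_finset.
by apply: (SC); apply: sub_sigma_algebra; exists i, [set v i].
Qed.

End Filtration.

(** * The dyadic martingale *)

Section DyadicMartingale.
Context {R : realType} {K : numFieldType} (f : {rmorphism R -> K}).
Hypothesis f_le : {mono f : x y / x <= y}.
Context {X : completeNormedModType K} {n : nat}.
Variable x : nat -> X.
Implicit Types (v w : Omega n) (j : 'I_n) (a : Omega n -> R).

Definition combination a : X := \sum_(v : Omega n) f (a v) *: x (rank v).

Definition dyadic_martingale (k : nat) w : X := combination (cell_density k w).

Let f_ge0 r : (0 <= f r) = (0 <= r).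
Proof. by rewrite -(rmorph0 f) f_le. Qed.

(** The scalars [b] are kept apart from their real preimages [r] because they occur as 1 and as
    signs of [K]. *)
Lemma combination_sum (I : finType) (P : pred I) (b : I -> K)
    (a : I -> Omega n -> R) (r : I -> R) :
  (forall i, b i = f (r i)) ->
  \sum_(i | P i) b i *: combination (a i) =
    combination (fun v => \sum_(i | P i) r i * a i v).
Proof.
move=> br; rewrite /combination.
under eq_bigr => i _ do rewrite scaler_sumr.
rewrite exchange_big /=; apply: eq_bigr => v _.
rewrite rmorph_sum scaler_suml; apply: eq_bigr => i _.
by rewrite scalerA br -rmorphM.
Qed.

Lemma dM_dyadic j w :
  dM dyadic_martingale j.+1 w = combination (increment_density j w).
Proof.
rewrite /dM /dyadic_martingale /combination /= -sumrB; apply: eq_bigr => v _.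
by rewrite -scalerBl -rmorphB cell_densityB.
Qed.

Lemma dyadic_martingale_agree k v w : agree k v w ->
  dyadic_martingale k v = dyadic_martingale k w.
Proof.
move=> vw; apply: eq_bigr => u _; rewrite /cell_density; congr (f (_ * _%:R) *: _).
congr nat_of_bool; apply/idP/idP => h; apply: agree_trans h _ => //.
by rewrite agree_sym.
Qed.

(** A set of the [k]-th sigma-algebra is invariant under flipping coordinate [k], while the
    increment changes sign, so its sum over the set vanishes. *)
Lemma dyadic_walsh_paley : walsh_paley dyadic_martingale.
Proof.
split=> [k kn U _|k kn A /filtration_saturated sA].
  apply: saturated_filtration => v w vw.
  by rewrite /preimage /= (dyadic_martingale_agree vw).
congr (_ *: _); apply/eqP; rewrite -subr_eq0 -sumrB; apply/eqP.
pose j := Ordinal kn.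
have -> : \sum_(w | w \in A) (dyadic_martingale k.+1 w - dyadic_martingale k w) =
    \sum_(w | w \in A) 1 *: combination (increment_density j w).
  by apply: eq_bigr => w _; rewrite scale1r -dM_dyadic.
rewrite (combination_sum _ _ (r := fun=> 1)) => [|i]; last by rewrite rmorph1.
rewrite /combination big1// => v _.
rewrite (@sum_flip_odd _ _ _ j) ?rmorph0 ?scale0r// => w.
  apply/idP/idP => /set_mem Aw; apply/mem_set; apply: sA Aw.
    exact: agree_flip.
  by rewrite agree_sym agree_flip.
by move=> _; rewrite !mul1r increment_density_flip.
Qed.

Hypothesis x_le1 : forall i, (i < 2 ^ n)%N -> `|x i| <= 1.

Lemma dyadic_martingale_le1 k w : (k <= n)%N -> `|dyadic_martingale k w| <= 1.
Proof.
move=> kn; apply: (le_trans (ler_norm_sum _ _ _)).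
rewrite -(rmorph1 f) -(sum_agree w kn) mulr_sumr rmorph_sum [leRHS]big_mkcond /=.
apply: ler_sum => v _; rewrite normrZ ger0_norm; last first.
  by rewrite f_ge0 mulr_ge0// divr_ge0// exprn_ge0.
rewrite /cell_density; case: (agree k v w).
  by rewrite ler_piMr ?x_le1 ?rank_lt// f_ge0 mulr1 divr_ge0// exprn_ge0.
by rewrite mulr0 rmorph0 mul0r.
Qed.

Variable c : R.
Hypothesis x_ge : forall (a : nat -> R) (k : nat),
  f (c * `|\sum_(i < 2 ^ n | (k <= i)%N) a i|) <= `|\sum_(i < 2 ^ n) f (a i) *: x i|.

Lemma combination_ge t a : f (c * `|tail_sum t a|) <= `|combination a|.
Proof.
(* Coefficients are regrouped by the value of [rank], turning a sum over sign sequences into one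
   over indices below 2^n. *)
pose b i := \sum_(v | rank v == i) a v.
pose ord_rank v := Ordinal (rank_lt v).
have -> : combination a = \sum_(i < 2 ^ n) f (b i) *: x i.
  rewrite /combination (partition_big ord_rank xpredT) //=; apply: eq_bigr => i _.
  rewrite rmorph_sum scaler_suml; apply: eq_big => [v|v /eqP <-//].
  by rewrite -val_eqE.
have -> : tail_sum t a = \sum_(i < 2 ^ n | (t <= i)%N) b i; last exact: x_ge.
rewrite /tail_sum (partition_big ord_rank (fun i : 'I_(2 ^ n) => (t <= i)%N)) //=.
apply: eq_bigr => i ti; apply: eq_bigl => v; rewrite -val_eqE /=.
by case: eqP => [->|]; rewrite ?ti ?andbF.
Qed.

Lemma dM_dyadic_ge j w : f (c / 2) <= `|dM dyadic_martingale j.+1 w|.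
Proof.
have [t tE] := @half_tail R n j w.
by rewrite dM_dyadic -tE combination_ge.
Qed.

(** The same tail, starting at [rank w], serves every choice of signs: the signed sum of increments
    is again a combination, whose tail sum is a signed sum of reals, and Khinchine's inequality
    applies. *)
Lemma rademacher_average_ge w : 0 <= c ->
  f (c * (5 / 9) * Num.sqrt (\sum_j tail_sum (rank w) (increment_density j w) ^+ 2)) <=
    rademacher_average dyadic_martingale w.
Proof.
move=> c0; pose h j := tail_sum (rank w) (increment_density j w) : R.
apply: (@le_trans _ _ (f (c * ((2 ^+ n)^-1 *
    \sum_(e : Omega n) `|\sum_j (-1) ^+ e j * h j|)))).
  by rewrite f_le -mulrA ler_wpM2l//; exact: (khinchine h).
rewrite mulrCA mulr_sumr rmorphM fmorphV rmorphXn rmorph_nat rmorph_sum.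
rewrite /rademacher_average /expect_mu /integral_mu /= ler_wpM2l ?invr_ge0 ?exprn_ge0//.
rewrite [leRHS](eq_bigl xpredT) => [|e]; last by rewrite in_setT.
apply: ler_sum => e _.
under [in leRHS]eq_bigr => j _ do rewrite dM_dyadic.
rewrite (combination_sum _ _ (r := fun j => (-1) ^+ e j)) => [|j]; last by rewrite rmorph_sign.
have -> : \sum_j (-1) ^+ e j * h j =
    tail_sum (rank w) (fun v => \sum_j (-1) ^+ e j * increment_density j w v).
  rewrite /tail_sum exchange_big /=; apply: eq_bigr => j _.
  by rewrite /h /tail_sum mulr_sumr.
exact: combination_ge.
Qed.

End DyadicMartingale.

(** * Constants and conclusion *)

Lemma turns_sum_sqr (R : realType) (n : nat) (w : Omega n) : (n <= 4 * turns w)%N ->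
  Num.sqrt n%:R / 8 <=
    Num.sqrt (\sum_j tail_sum (rank w) (increment_density j w) ^+ 2) :> R.
Proof.
move=> nw; have -> : Num.sqrt n%:R / 8 = Num.sqrt (n%:R / 64) :> R.
  rewrite sqrtrM ?ler0n//; congr (_ * _).
  have -> : 64^-1 = 8^-1 ^+ 2 :> R by field.
  by rewrite sqrtr_sqr ger0_norm.
rewrite ler_wsqrtr//; apply: (@le_trans _ _ ((turns w)%:R / 16)).
  (* At least n/4 turns, each contributing 1/16, give n/64. *)
  have : n%:R <= (4 * turns w)%:R :> R by rewrite ler_nat.
  by rewrite natrM; lra.
rewrite /turns -sum1_card natr_sum mulr_suml big_mkcond /=; apply: ler_sum => j _.
case: ifP => [tj|_]; last exact: sqr_ge0.
have := turn_tail (R := R) tj; rewrite -[_ ^+ 2]real_normK ?num_real//.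
set u := `|_|; move=> u4; have : 4^-1 ^+ 2 <= u ^+ 2 by rewrite ler_pXn2r ?nnegrE//; lra.
by lra.
Qed.

Local Close Scope classical_set_scope.

Theorem theorem4p3 (R : realType) :
  exists alpha beta : R, 0 < alpha /\ 0 < beta /\
    forall (K : numFieldType) (iota : R -> K), real_or_complex iota ->
    forall X : completeNormedModType K, ~ superreflexive X ->
    forall theta : R, 0 < theta ->
    forall n : nat, (1 <= n)%N ->
    exists M : nat -> Omega n -> X,
      [/\ walsh_paley M,
          (forall (k : nat) (w : Omega n), (k <= n)%N -> `|M k w| <= 1),
          (forall (k : nat) (w : Omega n), (1 <= k <= n)%N ->
             iota (1 / (2 * (1 + theta))) <= `|dM M k w|) &
          beta < mu R [set w : Omega n |
                         iota (alpha * Num.sqrt n%:R)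
                           <= rademacher_average M w]].
Proof.
(* With [c >= 1/2], Khinchine's 5/9 and the factor 1/8 from the turns, the constant is at least
   5/144 > 1/32; 1/4 is the proportion in [many_turns]. *)
exists 32^-1, 4^-1; do 2 (split; first by rewrite invr_gt0).
move=> K iota roc X nX theta theta0 n n1.
(* Shrinking [theta] to at most [1] keeps [alpha] independent of [theta]. *)
pose c := (1 + Num.min theta 1)^-1.
have m0 : 0 < Num.min theta 1 by rewrite lt_min theta0 ltr01.
have m1 : Num.min theta 1 <= 1 by rewrite ge_min lexx orbT.
have mt : Num.min theta 1 <= theta by rewrite ge_min lexx.
have c0 : 0 < c by rewrite invr_gt0; lra.
have c1 : c < 1 by rewrite invf_lt1; lra.
have c2 : 2^-1 <= c by rewrite lef_pV2 ?posrE; lra.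
have c01 : 0 < c < 1 by rewrite c0.
have [x [x1 xc]] := james_sequence_nonsuperreflexive roc nX (2 ^ n) c01.
have [f [fE f_le]] := real_or_complex_rmorphism roc; subst iota.
exists (dyadic_martingale f x); split.
- exact: dyadic_walsh_paley.
- by move=> k w; exact: dyadic_martingale_le1.
- move=> [//|k] w /= kn.
  apply: le_trans (dM_dyadic_ge xc (Ordinal kn) w).
  rewrite f_le div1r invfM mulrC ler_pM2r ?invr_gt0// lef_pV2 ?posrE; lra.
- apply: (lt_le_trans (many_turns n1)).
  rewrite /mu ler_pM2r ?invr_gt0 ?exprn_gt0// ler_nat; apply: subset_leq_card.
  apply/fintype.subsetP => w; rewrite !inE => nw.
  apply: le_trans (rademacher_average_ge f_le xc w (ltW c0)); rewrite f_le.
  have := turns_sum_sqr R nw; set s := Num.sqrt (\sum_j _) => le_s.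
  have s0 : 0 <= s by exact: sqrtr_ge0.
  have n0 : 0 <= Num.sqrt n%:R :> R by exact: sqrtr_ge0.
  have := ler_wpM2r s0 c2; lra.
Qed.
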